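(* Let $P$ be an ergodic hyperbounded Markov operator on a probability space $(S,\Sigma,\mu)$ mapping $L^2(\mu)$ to $L^3(\mu)$. If $\|P\|_{L^2\to L^3}<2^{1/6}$, then $P$ is aperiodic. The value $2^{1/6}$ is optimal, i.e. in this implication (for all such $P$ on all probability spaces) it cannot be replaced by any larger constant.
   Context: Let $(S,\Sigma,\mu)$ be a probability space and $P(x,A)$ a transition probability on $S\times\Sigma$, with Markov operator $Pf(x)=\int f(y)P(x,dy)$. $P$ is bi-stochastic if $\int P(x,A)\,d\mu(x)=\mu(A)$ for all $A\in\Sigma$; then $P$ induces a contraction of every $L^p(\mu)$. $P$ is hyperbounded if it is bi-stochastic and maps $L^p(\mu)$ into $L^q(\mu)$ for some $1<p<q\le\infty$. $P$ is ergodic if $Pf=f\in L^\infty(\mu)$ implies $f$ is constant a.e. A hyperbounded $P$ is quasi-compact in every complex $L^r(\mu)$, $1<r<\infty$ (i.e. some power is at operator-norm distance less than 1 from a compact operator); $\sigma(P)\cap\mathbb T$ is then a finite set of roots of unity, all of them eigenvalues, and the period of $P$ is the smallest integer $d\ge1$ such that $\lambda^d=1$ for every $\lambda\in\sigma(P)\cap\mathbb T$ (it does not depend on $r$). $P$ is aperiodic if its period is $d=1$. *)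

(* Defs.v *)
From HB Require Import structures.
From mathcomp Require Import all_boot all_order all_algebra.
From mathcomp Require Import all_classical all_reals all_analysis.
From mathcomp Require Import complex.

Set Implicit Arguments.
Unset Strict Implicit.
Unset Printing Implicit Defensive.

Import Order.TTheory GRing.Theory Num.Theory.
Import numFieldNormedType.Exports.

Local Open Scope classical_set_scope.
Local Open Scope ring_scope.
Local Open Scope complex_scope.

Section markov_operator.
Context {R : realType} {d : measure_display} {S : measurableType d}.
Variable mu : probability S R.
Variable P : R.-pker S ~> S.

Definition bistochastic : Prop :=
  forall A : set S, measurable A -> (\int[mu]_x P x A = mu A)%E.

(* Elements of the complex space L^p(mu) are represented by functions, and
   equality in L^p(mu) is equality mu-almost everywhere. *)
Definition cLnorm (p : \bar R) (f : S -> R[i]) : \bar R :=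
  Lnorm mu p (fun x => (Normc.normc (f x))%:E).

Definition cLfun (p : \bar R) : set (S -> R[i]) :=
  [set f | [/\ measurable_fun setT (fun x => complex.Re (f x)),
               measurable_fun setT (fun x => complex.Im (f x))
             & (cLnorm p f < +oo)%E]].

(* When P is bistochastic and f is in L^p(mu), 1 <= p, f is integrable with
   respect to P x for mu-almost every x; at the other points the value is a
   default one. *)
Definition Mop (f : S -> R[i]) : S -> R[i] := fun x =>
  (\int[P x]_y complex.Re (f y)) +i* (\int[P x]_y complex.Im (f y)).

Definition maps_Lp_Lq (p q : \bar R) : Prop :=
  forall f, cLfun p f -> cLfun q (Mop f).

Definition opnorm (p q : \bar R) : \bar R :=
  ereal_sup [set cLnorm q (Mop f) | f in [set f | cLfun p f /\
                                                 (cLnorm p f <= 1)%E]].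

Definition hyperbounded : Prop :=
  bistochastic /\
  exists p q : \bar R, [/\ (1 < p)%E, (p < q)%E & maps_Lp_Lq p q].

Definition ergodic : Prop :=
  forall f, cLfun +oo%E f -> Mop f = f %[ae mu] ->
  exists c : R[i], f = cst c %[ae mu].

Definition shifted (l : R[i]) (f : S -> R[i]) : S -> R[i] :=
  fun x => l * f x - Mop f x.

(* l *: id - P is a bijection of L^r(mu) onto itself with bounded inverse *)
Definition resolvent_set (r : \bar R) (l : R[i]) : Prop :=
  [/\ forall g, cLfun r g ->
        exists2 f, cLfun r f & shifted l f = g %[ae mu],
      forall f, cLfun r f -> shifted l f = cst 0 %[ae mu] ->
        f = cst 0 %[ae mu]
    & exists C : R, forall f, cLfun r f ->
        (cLnorm r f <= C%:E * cLnorm r (shifted l f))%E].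

Definition spectrum (r : \bar R) : set R[i] :=
  [set l | ~ resolvent_set r l].

Definition peripheral_exponent (r : \bar R) (n : nat) : Prop :=
  (0 < n)%N /\
  forall l : R[i], spectrum r l -> `|l| = 1 -> l ^+ n = 1.

Definition is_period (r : \bar R) (n : nat) : Prop :=
  peripheral_exponent r n /\
  forall m : nat, peripheral_exponent r m -> (n <= m)%N.

Definition aperiodic (r : \bar R) : Prop := is_period r 1.

End markov_operator.

(* The exponent r is that of the space L^r(mu) in which the spectrum, hence the
   period, is taken. *)
Definition aperiodicity_bound (R : realType) (r c : R) : Prop :=
  forall (d : measure_display) (S : measurableType d) (mu : probability S R)
         (P : R.-pker S ~> S),
    hyperbounded mu P -> ergodic mu P -> maps_Lp_Lq mu P 2%:E 3%:E ->
    (opnorm mu P 2%:E 3%:E < c%:E)%E ->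
    aperiodic mu P r%:E.

(* Main.v *)
From HB Require Import structures.
Require Import Defs.
From mathcomp Require Import all_boot all_order all_algebra.
From mathcomp Require Import all_classical all_reals all_analysis.
From mathcomp Require Import measurable_realfun complex ring lra.

(* Idea.  Let theta be the norm of P from L^2 to L^3.  For a real f with mean 0
   and L^2-norm at most 1, the pointwise inequality
   |1 + t|^3 + |1 - t|^3 >= 2 + 6 t^2 gives
     2 + 6 |Pf|_2^2 <= |P(1 + f)|_3^3 + |P(1 - f)|_3^3 <= 2 theta^3 2^(3/2),
   so that P is a strict contraction of the functions of mean 0 in L^2 as soon
   as theta < 2^(1/6).  Hence l - P is invertible on L^2 for every l <> 1 on the
   unit circle (Neumann series).  By interpolation P maps every L^p, 1 < p, into
   some L^q with q > p, and invertibility passes from L^q to L^p and from L^p to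
   L^q through (l - P)^-1 = l^-1 (1 + (l - P)^-1 P) = l^-1 (1 + P (l - P)^-1);
   starting from p = 2, all the exponents r > 1 are reached.  The constant is
   attained by the flip of the two-point space with uniform measure, which has
   the eigenvalue -1. *)

Set Implicit Arguments.
Unset Strict Implicit.
Unset Printing Implicit Defensive.

Import Order.TTheory GRing.Theory Num.Theory.
Import numFieldNormedType.Exports.

Local Open Scope classical_set_scope.
Local Open Scope ring_scope.

Local Notation normc := Normc.normc.
Local Notation Re := complex.Re.
Local Notation Im := complex.Im.

(** * Averaging against a bistochastic kernel *)

(** The number 2^(1/6) is where the gap closes: [1 + f] and [1 - f] have L^2-norm at most 2^(1/2),
    so |Pf|_2^2 <= rho with rho = (theta^3 2^(3/2) - 1) / 3, and rho < 1 exactly when theta^3 <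
    2^(1/2). Two kinds of constants occur. The factor rho must survive the passage to complex
    functions, which it does because the squared L^2-norm is the sum of those of the real and
    imaginary parts. All other bounds (monotonicity of the norms in the exponent, interpolation)
    only have to be finite, so crude factors 2 and 4 replace the sharp inequalities of Jensen and
    Riesz-Thorin. Elements of L^p being functions, the Neumann series is not summed by completeness
    of a quotient: a square-integrable majorant makes it converge almost everywhere, and [P] is
    exchanged with the sum by dominated convergence under [P x]. This settles the functions of mean
    0; on the constants, which [P] fixes, [l - P] is multiplication by l - 1. *)

Section kernel_averages.
Context {R : realType} {d : measure_display} {S : measurableType d}.
Variable mu : probability S R.
Variable P : R.-pker S ~> S.
Hypothesis biP : bistochastic mu P.

Import HBNNSimple.
Local Open Scope ereal_scope.

Lemma measurable_kernel_integral (g : S -> \bar R) :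
  (forall x, 0 <= g x) -> measurable_fun setT g ->
  measurable_fun setT (fun x => \int[P x]_y g y).
Proof.
move=> g0 mg; apply: measurable_fun_integral_kernel => //.
exact: measurable_kernel.
Qed.

Let bistochastic_nnsfun (f : {nnsfun S >-> R}) :
  \int[mu]_x \int[P x]_y (f y)%:E = \int[mu]_x (f x)%:E.
Proof.
have E (m : {measure set S -> \bar R}) : \int[m]_z (f z)%:E =
    \sum_(r \in range f) (r%:E * m (f @^-1` [set r])).
  by rewrite integralT_nnsfun sintegralE.
under eq_integral do rewrite E.
rewrite E ge0_integral_fsum//; last 2 first.
- move=> r; apply: measurable_funeM.
  exact: measurable_kernel.
- by move=> r x _; exact: nnsfun_mulemu_ge0.
apply: eq_fsbigr => r /set_mem [x _ <-].
by rewrite ge0_integralZl ?biP//; [exact: measurable_kernel|rewrite lee_fin].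
Qed.

(** The invariance of [mu] extends from sets to nonnegative functions through simple functions, with
    monotone convergence used both inside, for each [P x], and outside, for [mu]. *)
Lemma bistochastic_integral (g : S -> \bar R) :
  (forall x, 0 <= g x) -> measurable_fun setT g ->
  \int[mu]_x \int[P x]_y g y = \int[mu]_x g x.
Proof.
move=> g0 mg; pose f_ := nnsfun_approx measurableT mg.
have mf n : measurable_fun setT (fun y => (f_ n y)%:E) by exact/measurable_EFinP.
have f0 n y : 0 <= (f_ n y)%:E by rewrite lee_fin.
have ndf y : {homo (fun n => (f_ n y)%:E) : m n / (m <= n)%N >-> m <= n}.
  by move=> m n mn; rewrite lee_fin; exact/lefP/nd_nnsfun_approx.
have E (m : {measure set S -> \bar R}) :
    \int[m]_y g y = limn (fun n => \int[m]_y (f_ n y)%:E).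
  rewrite -monotone_convergence//.
  by apply: eq_integral => y _; apply/esym/cvg_lim => //; exact: cvg_nnsfun_approx.
under eq_integral do rewrite E.
rewrite E monotone_convergence//; last 3 first.
- move=> n. by apply: measurable_kernel_integral.
- by move=> n x _; exact: integral_ge0.
- by move=> x _ m n mn; apply: ge0_le_integral => // y _; exact: ndf.
by congr (limn _); apply/funext => n; exact: bistochastic_nnsfun.
Qed.

(** A [mu]-null set [N] has [P x N = 0] for almost every [x], because the integral of [P x N] is
    [mu N = 0]. This makes [Mop] compatible with almost everywhere equality and carries pointwise
    bounds from [mu] to [P x]. *)
Lemma ae_kernel (B : S -> Prop) :
  {ae mu, forall x, B x} -> {ae mu, forall x, {ae P x, forall y, B y}}.
Proof.
move=> [N [mN N0 BN]].
have /(ae_eq_integral_abs mu measurableT (measurable_kernel P N mN)) PN0 :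
    \int[mu]_x `|P x N| = 0.
  by rewrite -N0 -biP//; apply: eq_integral => x _; rewrite gee0_abs.
by apply: filterS PN0 => x /= /(_ I) PxN; exists N.
Qed.

(** The real and imaginary parts of [Mop] are of this form. For integrable [u] the default value of
    the integral occurs only on a null set of points [x]. *)
Definition kavg (u : S -> R) (x : S) : R := (\int[P x]_y u y)%R.

Lemma measurable_kavg (u : S -> R) :
  measurable_fun setT u -> measurable_fun setT (kavg u).
Proof.
move=> mu_; apply: (measurableT_comp (f := fine)) => //.
rewrite (_ : (fun _ => _) = (fun x => \int[P x]_y ((EFin \o u)^\+ y)) \-
    (fun x => \int[P x]_y ((EFin \o u)^\- y))).
  by apply: emeasurable_funB; apply: measurable_kernel_integral => //;
    [exact/measurable_funepos/measurable_EFinP|exact/measurable_funeneg/measurable_EFinP].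
by apply/funext => x; rewrite integralE.
Qed.

(** By invariance the function sending [x] to the integral of |u| against [P x] has a finite
    integral, hence is finite almost everywhere. *)
Lemma ae_kernel_integrable (u : S -> R) : mu.-integrable setT (EFin \o u) ->
  {ae mu, forall x, (P x).-integrable setT (EFin \o u)}.
Proof.
move=> /integrableP[mu_ iu].
have mau : measurable_fun setT (abse \o (EFin \o u)) by exact: measurableT_comp.
have /integrable_ae : mu.-integrable setT
    (fun x => \int[P x]_y `|(EFin \o u) y|).
  apply/integrableP; split; first exact: measurable_kernel_integral.
  under eq_integral do rewrite gee0_abs ?integral_ge0//.
  by rewrite bistochastic_integral.
move=> /(_ measurableT); apply: filterS => x /(_ I) fx.
by apply/integrableP; split => //; rewrite ltey_eq fx.
Qed.

Lemma kavg_integrable (u : S -> R) : mu.-integrable setT (EFin \o u) ->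
  mu.-integrable setT (EFin \o kavg u).
Proof.
move=> iu; have := iu => /integrableP[mEu uoo].
have mu_ : measurable_fun setT u by exact/measurable_EFinP.
have mau : measurable_fun setT (abse \o (EFin \o u)) by exact: measurableT_comp.
have mQ : measurable_fun setT (EFin \o kavg u).
  exact/measurable_EFinP/measurable_kavg.
have maQ : measurable_fun setT (abse \o (EFin \o kavg u)).
  exact: measurableT_comp.
have au0 x : 0 <= (abse \o (EFin \o u)) x by exact: abse_ge0.
apply/integrableP; split => //; apply: le_lt_trans uoo.
rewrite -(bistochastic_integral (g := abse \o (EFin \o u)))//.
apply: ae_ge0_le_integral => //.
- by move=> x _; exact: integral_ge0.
- exact: measurable_kernel_integral.
apply: filterS (ae_kernel_integrable iu) => x Pu _ /=.
by rewrite EFin_normr_Rintegral//; apply: le_abse_integral.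
Qed.

Lemma integral_kavg (u : S -> R) : mu.-integrable setT (EFin \o u) ->
  (\int[mu]_x kavg u x = \int[mu]_x u x)%R.
Proof.
move=> iu; have := iu => /integrableP[/measurable_EFinP mu_ uoo].
have ip := integrable_funepos measurableT iu.
have im := integrable_funeneg measurableT iu.
congr fine.
have mp : measurable_fun setT (EFin \o u)^\+ by exact: measurable_int ip.
have mm : measurable_fun setT (EFin \o u)^\- by exact: measurable_int im.
have fin (g : S -> \bar R) : (forall x, 0 <= g x) -> mu.-integrable setT g ->
    mu.-integrable setT (fun x => \int[P x]_y g y).
  move=> g0 /integrableP[mg goo]; apply/integrableP; split.
    exact: measurable_kernel_integral.
  under eq_integral do rewrite gee0_abs ?integral_ge0//.
  rewrite bistochastic_integral//.
  by under eq_integral do rewrite -[g _]gee0_abs//.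
transitivity (\int[mu]_x ((\int[P x]_y ((EFin \o u)^\+ y)) -
    (\int[P x]_y ((EFin \o u)^\- y)))).
  apply: ae_eq_integral => //.
  - exact/measurable_EFinP/measurable_kavg.
  - by apply: emeasurable_funB; apply: measurable_kernel_integral.
  apply: filterS (ae_kernel_integrable iu) => x Pu _ /=.
  by rewrite -integralE fineK//; apply: integrable_fin_num.
rewrite integralB//; [|exact: fin|exact: fin].
by rewrite !bistochastic_integral// -integralE.
Qed.

End kernel_averages.

(** * Complex L^p norms *)

Section complex_modulus.
Context {R : realType}.
Implicit Types z w : R[i].

Lemma normc_sqrt z : normc z = Num.sqrt (Re z ^+ 2 + Im z ^+ 2).
Proof. by case: z. Qed.

Lemma sqr_normc_ReIm z : normc z ^+ 2 = Re z ^+ 2 + Im z ^+ 2.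
Proof. by rewrite normc_sqrt sqr_sqrtr// addr_ge0 ?sqr_ge0. Qed.

Lemma normc_ge0 z : 0 <= normc z.
Proof. by rewrite normc_sqrt sqrtr_ge0. Qed.

Lemma normr_Re_le z : `|Re z| <= normc z.
Proof. by rewrite normc_sqrt -sqrtr_sqr ler_wsqrtr// lerDl sqr_ge0. Qed.

Lemma normr_Im_le z : `|Im z| <= normc z.
Proof. by rewrite normc_sqrt -sqrtr_sqr ler_wsqrtr// lerDr sqr_ge0. Qed.

Lemma normc_le_ReIm z : normc z <= `|Re z| + `|Im z|.
Proof.
rewrite normc_sqrt -[leRHS]ger0_norm ?addr_ge0// -sqrtr_sqr ler_wsqrtr//.
by rewrite sqrrD !real_normK ?num_real// -addrA lerD2l lerDr mulrn_wge0// mulr_ge0.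
Qed.

Lemma normc_real (a : R) : normc (a%:C)%C = `|a|.
Proof. by rewrite normc_sqrt /= expr0n addr0 sqrtr_sqr. Qed.

Lemma normc1_neq0 z : normc z = 1 -> z != 0.
Proof.
move=> z1; apply/eqP => z0; move: z1; rewrite z0 Normc.normc0 => /eqP.
by rewrite eq_sym oner_eq0.
Qed.

Lemma complexP z w : Re z = Re w -> Im z = Im w -> z = w.
Proof. by case: z w => [a b] [c e] /= -> ->. Qed.

Lemma Re_mulc z w : Re (z * w) = Re z * Re w - Im z * Im w.
Proof. by case: z w => [a b] [c e]. Qed.

Lemma Im_mulc z w : Im (z * w) = Re z * Im w + Im z * Re w.
Proof. by case: z w => [a b] [c e]. Qed.

Lemma Re_addc z w : Re (z + w) = Re z + Re w.
Proof. by case: z w => [a b] [c e]. Qed.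

Lemma Im_addc z w : Im (z + w) = Im z + Im w.
Proof. by case: z w => [a b] [c e]. Qed.

End complex_modulus.

Lemma integral_cst_mass1 (R : realType) (d : measure_display)
    (S : measurableType d) (m : {measure set S -> \bar R}) (c : R) :
  m setT = 1%E -> (\int[m]_x c%:E = c%:E)%E.
Proof. by move=> m1; rewrite (integral_cst _ _ c%:E)// m1 mule1. Qed.

Lemma integrable_cst_mass1 (R : realType) (d : measure_display)
    (S : measurableType d) (m : {measure set S -> \bar R}) (c : R) :
  m setT = 1%E -> m.-integrable setT (EFin \o (fun=> c)).
Proof.
move=> m1; apply/integrableP; split; first exact: measurable_cst.
by rewrite (eq_integral (fun=> `|c|%:E))// integral_cst_mass1// ltry.
Qed.

Section complex_Lp.
Context {R : realType} {d : measure_display} {S : measurableType d}.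
Variable mu : probability S R.
Implicit Types (f g : S -> R[i]) (p q s : R) (c : R[i]).

Definition cmeas f : Prop :=
  measurable_fun setT (fun x => Re (f x)) /\
  measurable_fun setT (fun x => Im (f x)).

Lemma measurable_normc f : cmeas f -> measurable_fun setT (fun x => normc (f x)).
Proof.
move=> [mr mi].
rewrite (_ : (fun _ => _) =
    (fun x => (Re (f x) ^+ 2 + Im (f x) ^+ 2) `^ 2^-1)); last first.
  by apply/funext => x; rewrite normc_sqrt powR12_sqrt// addr_ge0 ?sqr_ge0.
apply: (measurableT_comp (measurable_powR _)).
by apply: measurable_funD; exact: measurable_funX.
Qed.

Lemma cmeasD f g : cmeas f -> cmeas g -> cmeas (fun x => f x + g x).
Proof.
move=> [mrf mif] [mrg mig]; split.
  by under eq_fun do rewrite Re_addc; exact: measurable_funD.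
by under eq_fun do rewrite Im_addc; exact: measurable_funD.
Qed.

Lemma cmeasZ c f : cmeas f -> cmeas (fun x => c * f x).
Proof.
move=> [mrf mif]; split.
  by under eq_fun do rewrite Re_mulc; apply: measurable_funB; exact: measurable_funM.
by under eq_fun do rewrite Im_mulc; apply: measurable_funD; exact: measurable_funM.
Qed.

Lemma cmeas_cst c : cmeas (cst c).
Proof. by split; exact: measurable_cst. Qed.

Lemma measurable_normc_powR f p : cmeas f ->
  measurable_fun setT (fun x => (normc (f x) `^ p)%:E).
Proof.
move=> mf; apply/measurable_EFinP/(measurableT_comp (measurable_powR _)).
exact: measurable_normc.
Qed.

Lemma cLnorm_ge0 p f : (0 <= cLnorm mu p%:E f)%E.
Proof. exact: Lnorm_ge0. Qed.

Lemma cLnormE p f :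
  (cLnorm mu p%:E f = (\int[mu]_x (normc (f x) `^ p)%:E) `^ p^-1)%E.
Proof.
rewrite /cLnorm unlock.
by under eq_integral do rewrite gee0_abs ?lee_fin ?normc_ge0// poweR_EFin.
Qed.

Lemma cLnorm_powR p f : p != 0 ->
  (cLnorm mu p%:E f `^ p = \int[mu]_x (normc (f x) `^ p)%:E)%E.
Proof.
move=> p0; rewrite cLnormE -poweRrM mulVf// poweRe1//.
by apply: integral_ge0 => x _; rewrite lee_fin powR_ge0.
Qed.

Lemma cLnorm_le p f s : 0 < p -> 0 <= s ->
  (cLnorm mu p%:E f <= s%:E)%E =
  (\int[mu]_x (normc (f x) `^ p)%:E <= (s `^ p)%:E)%E.
Proof.
move=> p0 s0; rewrite -cLnorm_powR ?gt_eqF//; apply/idP/idP => h.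
  rewrite -poweR_EFin gt0_ler_poweR ?(ltW p0)//.
  - by rewrite in_itv/= leey cLnorm_ge0.
  - by rewrite in_itv/= leey lee_fin s0.
have : ((cLnorm mu p%:E f `^ p) `^ p^-1 <= (s `^ p)%:E `^ p^-1)%E.
  rewrite gt0_ler_poweR ?invr_ge0 ?(ltW p0)//.
  - by rewrite in_itv/= leey poweR_ge0.
  - by rewrite in_itv/= leey lee_fin powR_ge0.
by rewrite -poweRrM poweR_EFin -powRrM mulfV ?gt_eqF// poweRe1 ?cLnorm_ge0// powRr1.
Qed.

Lemma cLnorm_lty p f : 0 < p ->
  (cLnorm mu p%:E f < +oo)%E <-> (\int[mu]_x (normc (f x) `^ p)%:E < +oo)%E.
Proof.
move=> p0; rewrite -cLnorm_powR ?gt_eqF//; split; first exact: poweR_lty.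
by apply: lty_poweRy; rewrite gt_eqF.
Qed.

Lemma cLnorm_le_ae p f g : 0 < p -> cmeas f -> cmeas g ->
  {ae mu, forall x, normc (f x) <= normc (g x)} ->
  (cLnorm mu p%:E f <= cLnorm mu p%:E g)%E.
Proof.
move=> p0 mf mg fg; have [goo|] := ltP (cLnorm mu p%:E g) +oo%E; last first.
  by rewrite leye_eq => /eqP ->; rewrite leey.
have gfin : cLnorm mu p%:E g \is a fin_num by rewrite ge0_fin_numE ?cLnorm_ge0.
rewrite -(fineK gfin) cLnorm_le ?fine_ge0 ?cLnorm_ge0//.
rewrite -poweR_EFin (fineK gfin) cLnorm_powR; last by rewrite gt_eqF.
apply: ae_ge0_le_integral => //.
- by move=> x _; rewrite lee_fin powR_ge0.
- exact: measurable_normc_powR.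
- by move=> x _; rewrite lee_fin powR_ge0.
- exact: measurable_normc_powR.
apply: filterS fg => x fg _; rewrite lee_fin ge0_ler_powR ?(ltW p0)//.
- by rewrite nnegrE normc_ge0.
- by rewrite nnegrE normc_ge0.
Qed.

Lemma cLnorm_eq_ae p f g : 0 < p -> cmeas f -> cmeas g ->
  {ae mu, forall x, f x = g x} -> cLnorm mu p%:E f = cLnorm mu p%:E g.
Proof.
move=> p0 mf mg fg; apply/eqP; rewrite eq_le !cLnorm_le_ae//.
- by apply: filterS fg => x ->.
- by apply: filterS fg => x ->.
Qed.

Lemma cLnormD p f g : 1 <= p -> cmeas f -> cmeas g ->
  (cLnorm mu p%:E (fun x => (f x + g x)%R) <= cLnorm mu p%:E f + cLnorm mu p%:E g)%E.
Proof.
move=> p1 mf mg; have p0 : 0 < p by rewrite (lt_le_trans ltr01).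
have := minkowski_EFin mu (measurable_normc mf) (measurable_normc mg) p1.
apply: le_trans.
have := @cLnorm_le_ae p (fun x => f x + g x)
  (fun x => ((normc (f x) + normc (g x))%:C)%C) p0 (cmeasD mf mg).
have E : cLnorm mu p%:E (fun x => ((normc (f x) + normc (g x))%:C)%C) =
    Lnorm mu p%:E (EFin \o ((fun x => normc (f x)) \+ (fun x => normc (g x)))).
  by apply: eq_Lnorm => x; rewrite normc_real /= ger0_norm// addr_ge0 ?normc_ge0.
rewrite E; apply.
  by split => //=; apply: measurable_funD; exact: measurable_normc.
by apply: aeW => x; rewrite normc_real ger0_norm ?addr_ge0 ?normc_ge0 ?le_normcD.
Qed.

Lemma cLnormZ p c f : 0 < p -> cmeas f ->
  (cLnorm mu p%:E (fun x => (c * f x)%R) = (normc c)%:E * cLnorm mu p%:E f)%E.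
Proof.
move=> p0 mf; rewrite !cLnormE.
under eq_integral do rewrite Normc.normcM powRM ?normc_ge0// EFinM.
rewrite ge0_integralZl_EFin ?powR_ge0//; last 2 first.
- by move=> x _; rewrite lee_fin powR_ge0.
- exact: measurable_normc_powR.
have I0 : (0 <= \int[mu]_x (normc (f x) `^ p)%:E)%E.
  by apply: integral_ge0 => x _; rewrite lee_fin powR_ge0.
rewrite poweRM ?lee_fin ?powR_ge0//.
by rewrite poweR_EFin -powRrM mulfV ?gt_eqF// powRr1 ?normc_ge0.
Qed.

Lemma cLfunP p f : cLfun mu p%:E f <-> cmeas f /\ (cLnorm mu p%:E f < +oo)%E.
Proof. by split => [[]|[[]]]. Qed.

Lemma cLfunD p f g : 1 <= p -> cLfun mu p%:E f -> cLfun mu p%:E g ->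
  cLfun mu p%:E (fun x => f x + g x).
Proof.
move=> p1 /cLfunP[mf fo] /cLfunP[mg go]; apply/cLfunP; split; first exact: cmeasD.
by apply: le_lt_trans (cLnormD p1 mf mg) _; rewrite lte_add_pinfty.
Qed.

Lemma cLfunZ p c f : 0 < p -> cLfun mu p%:E f -> cLfun mu p%:E (fun x => c * f x).
Proof.
move=> p0 /cLfunP[mf fo]; apply/cLfunP; split; first exact: cmeasZ.
by rewrite cLnormZ// lte_mul_pinfty// lee_fin normc_ge0.
Qed.

Lemma cLfun_cst p c : 0 < p -> cLfun mu p%:E (cst c).
Proof.
move=> p0; apply/cLfunP; split; first exact: cmeas_cst.
apply/cLnorm_lty => //; rewrite (eq_integral (fun=> (normc c `^ p)%:E))//.
by rewrite integral_cst_mass1 ?ltry//; exact: probability_setT.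
Qed.

Lemma cLnorm_eq0 p f : 0 < p -> cmeas f -> cLnorm mu p%:E f = 0 ->
  {ae mu, forall x, f x = 0}.
Proof.
move=> p0 mf f0.
have mEf : measurable_fun setT (EFin \o (fun x => normc (f x))).
  exact/measurable_EFinP/measurable_normc.
apply: filterS (Lnorm_eq0_eq0 mEf _ f0); rewrite ?lte_fin// => x /(_ I) [].
exact: Normc.eq0_normc.
Qed.

(** Homogeneity. As the norm of [f] may vanish, [f] is divided by a slightly larger number, and the
    excess tends to 0. It serves for norms and for norms of images under [Mop]. *)
Lemma cLnorm_le_of_unit_ball p s (T : (S -> R[i]) -> \bar R) : 0 < p -> 0 <= s ->
  (forall f (c : R), 0 < c -> cLfun mu p%:E f ->
     T (fun x => (c%:C)%C * f x) = (c%:E * T f)%E) ->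
  (forall f, cLfun mu p%:E f -> (cLnorm mu p%:E f <= 1)%E -> (T f <= s%:E)%E) ->
  forall f, cLfun mu p%:E f -> (T f <= s%:E * cLnorm mu p%:E f)%E.
Proof.
move=> p0 s0 TZ T1 f Lf; have /cLfunP[mf foo] := Lf.
have ffin : cLnorm mu p%:E f \is a fin_num by rewrite ge0_fin_numE ?cLnorm_ge0.
set a := fine (cLnorm mu p%:E f).
have a0 : 0 <= a by rewrite fine_ge0 ?cLnorm_ge0.
rewrite -(fineK ffin) -/a -EFinM; apply/lee_addgt0Pr => e e0.
(* Chosen so that [s * b <= s * a + e]; the [+ 1] covers the case [s = 0]. *)
pose b := a + e / (s + 1).
have s10 : 0 < s + 1 by rewrite ltr_wpDl.
have b0 : 0 < b by rewrite ltr_wpDl// divr_gt0.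
have bi0 : 0 < b^-1 by rewrite invr_gt0.
have N1 : (cLnorm mu p%:E (fun x => (((b^-1)%:C)%C * f x)%R) <= 1)%E.
  rewrite cLnormZ// normc_real gtr0_norm// -(fineK ffin) -/a -EFinM lee_fin.
  rewrite mulrC ler_pdivrMr// mul1r lerDl.
  by rewrite divr_ge0 ?(ltW s10) ?(ltW e0).
have := T1 _ (cLfunZ (b^-1)%:C%C p0 Lf) N1; rewrite TZ// lee_pdivrMl// -EFinM.
move=> /le_trans; apply; rewrite -EFinD lee_fin mulrC /b mulrDr lerD2l.
by rewrite mulrA ler_pdivrMr// mulrC ler_wpM2l ?(ltW e0)// lerDl.
Qed.

(** The pointwise bound t^p <= 1 + t^q, integrated over a space of mass 1, gives the factor 2^(1/p)
    on the unit ball. *)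
Lemma cLnorm_monotone p q f : 0 < p <= q -> cLfun mu q%:E f ->
  (cLnorm mu p%:E f <= (2 `^ p^-1)%:E * cLnorm mu q%:E f)%E.
Proof.
move=> /andP[p0 pq]; have q0 := lt_le_trans p0 pq.
apply: cLnorm_le_of_unit_ball => //.
  move=> {}f c c0 /cLfunP[mf _].
  by rewrite cLnormZ// normc_real gtr0_norm.
move=> {}f /cLfunP[mf foo].
rewrite (@cLnorm_le q f 1)// powR1 => fle.
rewrite cLnorm_le ?powR_ge0// -powRrM mulVf ?gt_eqF// powRr1//.
apply: (@le_trans _ _ (\int[mu]_x (1 + (normc (f x) `^ q)%:E)))%E.
  apply: ge0_le_integral => //.
  - by move=> x _; rewrite lee_fin powR_ge0.
  - exact: measurable_normc_powR.
  - by apply: emeasurable_funD => //; exact: measurable_normc_powR.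
  move=> x _; rewrite -EFinD lee_fin.
  have [f1|f1] := leP (normc (f x)) 1.
    rewrite ler_wpDr ?powR_ge0//.
    have := @ge0_ler_powR R p (ltW p0) (normc (f x)) 1.
    by rewrite !nnegrE normc_ge0 ler01 powR1 => ->.
  by rewrite ler_wpDl// ler_powR// (ltW f1).
rewrite ge0_integralD//; last 2 first.
- by move=> x _; rewrite lee_fin powR_ge0.
- exact: measurable_normc_powR.
rewrite integral_cst_mass1; last exact: probability_setT.
by apply: le_trans (leeD (lexx _) fle) _; rewrite -EFinD lee_fin.
Qed.

Lemma cLfun_subset p q f : 0 < p <= q -> cLfun mu q%:E f -> cLfun mu p%:E f.
Proof.
move=> pq Lf; have /cLfunP[mf foo] := Lf; apply/cLfunP; split => //.
by apply: le_lt_trans (cLnorm_monotone pq Lf) _; rewrite lte_mul_pinfty ?lee_fin ?powR_ge0.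
Qed.

End complex_Lp.

(** * The Markov operator on L^p *)

Section Markov_on_Lp.
Context {R : realType} {d : measure_display} {S : measurableType d}.
Variable mu : probability S R.
Variable P : R.-pker S ~> S.
Hypothesis biP : bistochastic mu P.
Implicit Types (f g : S -> R[i]) (p q s : R) (c l : R[i]).

Definition cintegrable (m : {measure set S -> \bar R}) f : Prop :=
  m.-integrable setT (EFin \o (fun x => Re (f x))) /\
  m.-integrable setT (EFin \o (fun x => Im (f x))).

Lemma cLfun_normc_integrable p f : 1 <= p -> cLfun mu p%:E f ->
  mu.-integrable setT (EFin \o (fun x => normc (f x))).
Proof.
move=> p1 Lf; have L1f : cLfun mu 1%:E f.
  by apply: (@cLfun_subset _ _ _ _ _ p) => //; rewrite ltr01.
have /cLfunP[mf /cLnorm_lty] := L1f.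
move=> /(_ ltr01); under eq_integral do rewrite powRr1 ?normc_ge0//.
move=> foo; apply/integrableP; split.
  exact/measurable_EFinP/measurable_normc.
by under eq_integral do rewrite gee0_abs ?lee_fin ?normc_ge0//.
Qed.

Lemma normc_cintegrable (m : {measure set S -> \bar R}) f : cmeas f ->
  m.-integrable setT (EFin \o (fun x => normc (f x))) -> cintegrable m f.
Proof.
move=> [mr mi] If; split; apply: le_integrable If => //.
- exact/measurable_EFinP.
- by move=> x _; rewrite lee_fin (ger0_norm (normc_ge0 _)) normr_Re_le.
- exact/measurable_EFinP.
- by move=> x _; rewrite lee_fin (ger0_norm (normc_ge0 _)) normr_Im_le.
Qed.

Lemma cLfun_cintegrable p f : 1 <= p -> cLfun mu p%:E f -> cintegrable mu f.
Proof.
move=> p1 Lf; apply: normc_cintegrable; first by have /cLfunP[] := Lf.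
exact: cLfun_normc_integrable Lf.
Qed.

Lemma ae_kernel_cintegrable f : cintegrable mu f ->
  {ae mu, forall x, cintegrable (P x) f}.
Proof.
move=> [ir ii].
by apply: filterS2 (ae_kernel_integrable biP ir) (ae_kernel_integrable biP ii).
Qed.

Lemma cmeas_Mop f : cmeas f -> cmeas (Mop P f).
Proof. by move=> [mr mi]; split; exact: measurable_kavg. Qed.

Lemma cintegrable_Mop f : cintegrable mu f -> cintegrable mu (Mop P f).
Proof. by move=> [mr mi]; split; exact: kavg_integrable. Qed.

Lemma MopD f g : cintegrable mu f -> cintegrable mu g ->
  {ae mu, forall x, Mop P (fun y => f y + g y) x = Mop P f x + Mop P g x}.
Proof.
move=> If Ig.
apply: filterS2 (ae_kernel_cintegrable If) (ae_kernel_cintegrable Ig) => x.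
move=> [rf jf] [rg jg]; apply: complexP; rewrite ?Re_addc ?Im_addc /=.
  by under eq_Rintegral do rewrite Re_addc; rewrite RintegralD.
by under eq_Rintegral do rewrite Im_addc; rewrite RintegralD.
Qed.

Lemma integrableZ (m : {measure set S -> \bar R}) (u : S -> R) (a : R) :
  m.-integrable setT (EFin \o u) ->
  m.-integrable setT (EFin \o (fun x => a * u x)).
Proof. by move=> iu; exact: (integrableZl measurableT a iu). Qed.

Lemma MopZ c f : cintegrable mu f ->
  {ae mu, forall x, Mop P (fun y => c * f y) x = c * Mop P f x}.
Proof.
move=> If; apply: filterS (ae_kernel_cintegrable If) => x [rf jf].
apply: complexP; rewrite ?Re_mulc ?Im_mulc /=.
  under eq_Rintegral do rewrite Re_mulc.
  by rewrite RintegralB ?RintegralZl//; exact: integrableZ.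
under eq_Rintegral do rewrite Im_mulc.
by rewrite RintegralD ?RintegralZl//; exact: integrableZ.
Qed.

Lemma Mop_ae_eq f g : {ae mu, forall x, f x = g x} -> cmeas f -> cmeas g ->
  {ae mu, forall x, Mop P f x = Mop P g x}.
Proof.
move=> fg [rf jf] [rg jg]; apply: filterS (ae_kernel biP fg) => x Pfg.
rewrite /Mop /Rintegral; congr (fine _ +i* fine _)%C; apply: ae_eq_integral => //.
- exact/measurable_EFinP.
- exact/measurable_EFinP.
- by apply: filterS Pfg => y -> _.
- exact/measurable_EFinP.
- exact/measurable_EFinP.
- by apply: filterS Pfg => y -> _.
Qed.

Lemma Mop_cst c : Mop P (cst c) = cst c.
Proof.
apply/funext => x; rewrite /Mop /Rintegral !integral_cst_mass1 ?prob_kernel//.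
by case: c.
Qed.

Lemma cintegrableZ c f : cintegrable mu f -> cintegrable mu (fun x => c * f x).
Proof.
move=> [rf jf]; split.
  rewrite (_ : _ \o _ = (EFin \o (fun x => (Re c * Re (f x))%R)) \-
    (EFin \o (fun x => (Im c * Im (f x))%R)))%E.
    by apply: integrableB => //; exact: integrableZ.
  by apply/funext => x /=; rewrite Re_mulc.
rewrite (_ : _ \o _ = (EFin \o (fun x => (Re c * Im (f x))%R)) \+
  (EFin \o (fun x => (Im c * Re (f x))%R)))%E.
  by apply: integrableD => //; exact: integrableZ.
by apply/funext => x /=; rewrite Im_mulc.
Qed.

Lemma cmeas_shifted l f : cmeas f -> cmeas (shifted P l f).
Proof.
move=> mf; rewrite (_ : shifted P l f = (fun x => l * f x + (- 1) * Mop P f x)).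
  by apply: cmeasD; [exact: cmeasZ|apply: cmeasZ; exact: cmeas_Mop].
by apply/funext => x; rewrite mulN1r.
Qed.

Lemma Mop_shifted l f : cintegrable mu f ->
  {ae mu, forall x, Mop P (shifted P l f) x = shifted P l (Mop P f) x}.
Proof.
move=> If.
rewrite (_ : shifted P l f = (fun x => l * f x + (- 1) * Mop P f x)); last first.
  by apply/funext => x; rewrite mulN1r.
have IPf := cintegrable_Mop If.
apply: filterS3 (MopD (cintegrableZ l If) (cintegrableZ (- 1) IPf))
  (MopZ l If) (MopZ (- 1) IPf) => x -> -> ->.
by rewrite /shifted mulN1r.
Qed.

(** The factor 2 comes from estimating the real and the imaginary part separately. *)
Lemma normc_Mop_le f : cmeas f ->
  mu.-integrable setT (EFin \o (fun x => normc (f x))) ->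
  {ae mu, forall x,
    normc (Mop P f x) <= 2 * kavg P (fun y => normc (f y)) x}.
Proof.
move=> mf If; have cIf := normc_cintegrable mf If.
apply: filterS2 (ae_kernel_integrable biP If) (ae_kernel_cintegrable cIf) => x.
move=> Inf [rf jf]; apply: le_trans (normc_le_ReIm _) _ => /=.
rewrite mulr_natl mulr2n lerD//.
  apply: le_trans (le_normr_Rintegral _ rf) _ => //; apply: le_Rintegral => //.
    exact: (integrable_abse rf).
  by move=> y _; exact: normr_Re_le.
apply: le_trans (le_normr_Rintegral _ jf) _ => //; apply: le_Rintegral => //.
  exact: (integrable_abse jf).
by move=> y _; exact: normr_Im_le.
Qed.

Definition Mop_bounded p q : Prop :=
  exists2 K : R, 0 <= K & forall f, cLfun mu p%:E f ->
    (cLnorm mu q%:E (Mop P f) <= K%:E * cLnorm mu p%:E f)%E.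

Lemma Mop_bounded_cLfun p q f : 0 < p -> Mop_bounded p q -> cLfun mu p%:E f ->
  cLfun mu q%:E (Mop P f).
Proof.
move=> p0 [K K0 PK] Lf; have /cLfunP[mf foo] := Lf.
apply/cLfunP; split; first exact: cmeas_Mop.
by apply: le_lt_trans (PK _ Lf) _; rewrite lte_mul_pinfty.
Qed.

(** Injectivity is contained in the lower bound. The sign of [C] allows constants for different
    exponents to be multiplied. *)
Definition shifted_invertible p l : Prop :=
  (forall g, cLfun mu p%:E g ->
     exists2 f, cLfun mu p%:E f & {ae mu, forall x, shifted P l f x = g x}) /\
  (exists2 C : R, 0 <= C & forall f, cLfun mu p%:E f ->
     (cLnorm mu p%:E f <= C%:E * cLnorm mu p%:E (shifted P l f))%E).

Lemma shifted_invertible_resolvent p l : 0 < p ->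
  shifted_invertible p l -> resolvent_set mu P p%:E l.
Proof.
move=> p0 [surj [C C0 bnd]]; split; last by exists C.
  move=> g Lg; have [f Lf fg] := surj g Lg; exists f => //.
  by apply: filterS fg => x ->.
move=> f Lf f0; have /cLfunP[mf foo] := Lf.
have f0' : {ae mu, forall x, shifted P l f x = cst 0 x}.
  by apply: filterS f0 => x /(_ I).
have N0 : cLnorm mu p%:E f = 0.
  apply/eqP; rewrite eq_le cLnorm_ge0 andbT.
  apply: le_trans (bnd _ Lf) _.
  rewrite (cLnorm_eq_ae p0 (cmeas_shifted l mf) (cmeas_cst 0) f0').
  rewrite (_ : cLnorm _ _ _ = 0) ?mule0//.
  rewrite cLnormE (eq_integral (fun=> 0%E)).
    by rewrite integral0 poweR0r// invr_neq0// gt_eqF.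
  move=> x _; rewrite (_ : normc (cst 0 x) = 0) ?powR0 ?gt_eqF//.
  exact: Normc.normc0.
by apply: filterS (cLnorm_eq0 p0 mf N0) => x ->.
Qed.

End Markov_on_Lp.

(** * Transfer of invertibility between exponents *)

Section transfer.
Context {R : realType} {d : measure_display} {S : measurableType d}.
Variable mu : probability S R.
Variable P : R.-pker S ~> S.
Hypothesis biP : bistochastic mu P.
Implicit Types (f g : S -> R[i]) (p q s : R) (c l : R[i]).

Lemma cLfun_shifted p l f : 1 <= p -> Mop_bounded mu P p p ->
  cLfun mu p%:E f -> cLfun mu p%:E (shifted P l f).
Proof.
move=> p1 bp Lf; have p0 := lt_le_trans ltr01 p1.
rewrite (_ : shifted P l f = (fun x => l * f x + (- 1) * Mop P f x)).
  by apply: cLfunD => //; apply: cLfunZ => //; exact: Mop_bounded_cLfun Lf.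
by apply/funext => x; rewrite mulN1r.
Qed.

Lemma Mop_bounded_diag p q : 0 < p <= q -> Mop_bounded mu P p q ->
  Mop_bounded mu P p p.
Proof.
move=> pq bpq; have /andP[p0 _] := pq; have [K K0 PK] := bpq.
exists (2 `^ p^-1 * K); first by rewrite mulr_ge0 ?powR_ge0.
move=> f Lf; apply: le_trans (cLnorm_monotone pq (Mop_bounded_cLfun p0 bpq Lf)) _.
by rewrite EFinM -muleA lee_wpmul2l ?lee_fin ?powR_ge0// PK.
Qed.

Lemma Mop_bounded_diagr p q : 0 < p <= q -> Mop_bounded mu P p q ->
  Mop_bounded mu P q q.
Proof.
move=> pq [K K0 PK]; exists (K * 2 `^ p^-1); first by rewrite mulr_ge0 ?powR_ge0.
move=> f Lf; apply: le_trans (PK _ (cLfun_subset pq Lf)) _.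
by rewrite EFinM -muleA lee_wpmul2l ?lee_fin// cLnorm_monotone.
Qed.

(** The source of both transfers below: up to the factor [l^-1], [f] is its image under [l - P] plus
    [Mop P f], and the latter lies in the better space L^q. *)
Lemma fixed_point_shifted l f : l != 0 ->
  forall x, f x = l^-1 * (shifted P l f x + Mop P f x).
Proof. by move=> l0 x; rewrite /shifted subrK mulKf. Qed.

Lemma shifted_invertible_down p q l : 1 <= p <= q -> normc l = 1 ->
  Mop_bounded mu P p q -> shifted_invertible mu P q l ->
  shifted_invertible mu P p l.
Proof.
move=> /andP[p1 pq] l1 bpq [surj [C C0 bnd]].
have p0 := lt_le_trans ltr01 p1; have q1 := le_trans p1 pq.
have q0 := lt_le_trans p0 pq.
have l0 := normc1_neq0 l1.
have pq' : 0 < p <= q by rewrite p0.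
have bpp := Mop_bounded_diag pq' bpq.
split.
  move=> g Lg; have [h Lh hg] := surj _ (Mop_bounded_cLfun p0 bpq Lg).
  have Lh' := cLfun_subset pq' Lh.
  exists (fun x => l^-1 * (g x + h x)); first by apply: cLfunZ => //; exact: cLfunD.
  have Ig := cLfun_cintegrable p1 Lg; have Ih := cLfun_cintegrable p1 Lh'.
  have Igh := cLfun_cintegrable p1 (cLfunD p1 Lg Lh').
  apply: filterS3 (MopZ biP l^-1 Igh) (MopD biP Ig Ih) hg => x E1 E2 E3.
  by rewrite /shifted E1 E2 -E3 /shifted mulVKf// subrK mulKf// addrK.
have [K K0 PK] := bpq.
exists (1 + 2 `^ p^-1 * (C * K)).
  by rewrite addr_ge0 ?mulr_ge0 ?powR_ge0.
move=> f Lf; have Lh := Mop_bounded_cLfun p0 bpq Lf.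
have /cLfunP[mf _] := Lf; have /cLfunP[mh _] := Lh.
have Lg := cLfun_shifted l p1 bpp Lf; have /cLfunP[mg _] := Lg.
(* [P] commutes with [l - P], so [Mop P f] solves in L^q the equation with right-hand side
   [Mop P (shifted P l f)]; the lower bound in L^q applies to it. *)
have hle : (cLnorm mu q%:E (Mop P f) <=
    (C * K)%:E * cLnorm mu p%:E (shifted P l f))%E.
  apply: le_trans (bnd _ Lh) _; rewrite EFinM -muleA lee_wpmul2l ?lee_fin//.
  rewrite (cLnorm_eq_ae (g := Mop P (shifted P l f)) q0).
  - exact: PK.
  - exact: cmeas_shifted.
  - exact: cmeas_Mop.
  - by apply: filterS (Mop_shifted biP l (cLfun_cintegrable p1 Lf)) => x ->.
rewrite [in leLHS](_ : f =
  (fun x => l^-1 * (shifted P l f x + Mop P f x))); last first.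
  by apply/funext => x; rewrite -fixed_point_shifted.
rewrite cLnormZ//; last exact: cmeasD.
rewrite Normc.normcV l1 invr1 mul1e; apply: le_trans (@cLnormD _ _ _ mu _ _ _ p1 mg mh) _.
rewrite EFinD ge0_muleDl ?mul1e ?lee_fin ?mulr_ge0 ?powR_ge0//.
rewrite leeD2l//; apply: le_trans (cLnorm_monotone pq' Lh) _.
by rewrite EFinM -muleA lee_wpmul2l ?lee_fin ?powR_ge0.
Qed.

Lemma shifted_invertible_up p q l : 1 <= p <= q -> normc l = 1 ->
  Mop_bounded mu P p q -> shifted_invertible mu P p l ->
  shifted_invertible mu P q l.
Proof.
move=> /andP[p1 pq] l1 bpq [surj [C C0 bnd]].
have p0 := lt_le_trans ltr01 p1; have q1 := le_trans p1 pq.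
have q0 := lt_le_trans p0 pq.
have l0 := normc1_neq0 l1.
have pq' : 0 < p <= q by rewrite p0.
have bqq := Mop_bounded_diagr pq' bpq.
split.
  move=> g Lg; have [f Lf fg] := surj _ (cLfun_subset pq' Lg).
  have Lh := Mop_bounded_cLfun p0 bpq Lf.
  (* The solution [f] is only known to be in L^p. This function is almost everywhere equal to it and
     is a combination of two elements of L^q. *)
  have Lf' : cLfun mu q%:E (fun x => l^-1 * (g x + Mop P f x)).
    by apply: cLfunZ => //; exact: cLfunD.
  exists (fun x => l^-1 * (g x + Mop P f x)) => //.
  have /cLfunP[mf _] := Lf; have /cLfunP[mf' _] := Lf'.
  have ff' : {ae mu, forall x, l^-1 * (g x + Mop P f x) = f x}.
    by apply: filterS fg => x <-; rewrite -fixed_point_shifted.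
  apply: filterS (Mop_ae_eq biP ff' mf' mf) => x E.
  by rewrite /shifted E mulVKf// addrK.
have [K K0 PK] := bpq.
exists (1 + K * (C * 2 `^ p^-1)).
  by rewrite addr_ge0 ?mulr_ge0 ?powR_ge0.
move=> f Lf; have Lfp := cLfun_subset pq' Lf.
have Lh := Mop_bounded_cLfun p0 bpq Lfp.
have Lg := cLfun_shifted l q1 bqq Lf.
have /cLfunP[mg _] := Lg; have /cLfunP[mh _] := Lh.
rewrite [in leLHS](_ : f =
  (fun x => l^-1 * (shifted P l f x + Mop P f x))); last first.
  by apply/funext => x; rewrite -fixed_point_shifted.
rewrite cLnormZ//; last exact: cmeasD.
rewrite Normc.normcV l1 invr1 mul1e; apply: le_trans (@cLnormD _ _ _ mu _ _ _ q1 mg mh) _.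
rewrite EFinD ge0_muleDl ?mul1e ?lee_fin ?mulr_ge0 ?powR_ge0//.
rewrite leeD2l//; apply: le_trans (PK _ Lfp) _.
rewrite EFinM -muleA lee_wpmul2l ?lee_fin//; apply: le_trans (bnd _ Lfp) _.
rewrite EFinM -muleA lee_wpmul2l ?lee_fin//; exact: cLnorm_monotone.
Qed.

End transfer.

(** * Improvement of integrability *)

Section bounds.
Context {R : realType} {d : measure_display} {S : measurableType d}.
Variable mu : probability S R.
Variable P : R.-pker S ~> S.
Hypothesis biP : bistochastic mu P.
Implicit Types (f g : S -> R[i]) (p q s : R) (c l : R[i]) (u v : S -> R).

Lemma cLnorm_MopZ p q (a : R) f : 1 <= p -> 0 < q -> 0 < a ->
  cLfun mu p%:E f ->
  cLnorm mu q%:E (Mop P (fun x => (a%:C)%C * f x)) =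
  (a%:E * cLnorm mu q%:E (Mop P f))%E.
Proof.
move=> p1 q0 a0 Lf; have /cLfunP[mf _] := Lf.
rewrite (cLnorm_eq_ae (g := fun x => (a%:C)%C * Mop P f x) q0).
- by rewrite cLnormZ ?normc_real ?gtr0_norm//; exact: cmeas_Mop.
- by apply: cmeas_Mop; exact: cmeasZ.
- by apply: cmeasZ; exact: cmeas_Mop.
- exact: (MopZ biP _ (cLfun_cintegrable p1 Lf)).
Qed.

Lemma Mop_bounded_ball p q s : 1 <= p -> 0 < q -> 0 <= s ->
  (forall f, cLfun mu p%:E f -> (cLnorm mu p%:E f <= 1)%E ->
     (cLnorm mu q%:E (Mop P f) <= s%:E)%E) ->
  Mop_bounded mu P p q.
Proof.
move=> p1 q0 s0 H; exists s => // f Lf.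
apply: (@cLnorm_le_of_unit_ball _ _ _ mu p s (fun g => cLnorm mu q%:E (Mop P g))) => //.
  exact: lt_le_trans ltr01 p1.
by move=> {H Lf}f c c0 Lf; exact: (cLnorm_MopZ p1).
Qed.

Lemma kavg0 : kavg P (cst 0) = cst 0.
Proof.
by apply/funext => x; rewrite /kavg /Rintegral integral_cst_mass1 ?prob_kernel.
Qed.

Lemma Mop_real u : Mop P (fun y => ((u y)%:C)%C) = fun x => ((kavg P u x)%:C)%C.
Proof.
by apply/funext => x; congr (_ +i* _)%C; exact: (congr1 (fun h => h x) kavg0).
Qed.

Lemma cmeas_real u : measurable_fun setT u -> cmeas (fun x => ((u x)%:C)%C).
Proof. by move=> mu_; split => //=; exact: measurable_cst. Qed.

Lemma kavg_ge0 u x : (forall y, 0 <= u y) -> 0 <= kavg P u x.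
Proof. by move=> u0; apply: Rintegral_ge0. Qed.

Lemma EFin_kavg u x : (P x).-integrable setT (EFin \o u) ->
  (kavg P u x)%:E = (\int[P x]_y (u y)%:E)%E.
Proof. by move=> iu; rewrite fineK//; exact: integrable_fin_num. Qed.

(* Interpolation by hand: for suitable [a], [b], [c] depending on the values of
   [P |f|^p] and [P |f|^(p/2)] at [x], the bound [t <= a + b t^(p/2) + c t^p]
   is integrated against [P x]. *)
Lemma Mop_bounded_interpolation p q : 1 < p -> 0 < q ->
  Mop_bounded mu P 2 3 ->
  (forall F G : R, 0 <= F -> 0 <= G -> exists a b c : R,
     (forall t : R, 0 <= t -> t <= a + b * t `^ (p / 2) + c * t `^ p) /\
     a + b * G + c * F <= 2 * (1 + F + G ^+ 3) `^ q^-1) ->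
  Mop_bounded mu P p q.
Proof.
move=> p1 q0 [K K0 PK] ineq; have p0 := lt_trans ltr01 p1.
(* With F and G the averages of |f|^p and |f|^(p/2), the integral of 1 + F + G^3 is at most 1 + 1 +
   K^3: invariance bounds that of F, and |f|^(p/2) is in the unit ball of L^2, which [P] maps into
   L^3. The 4 is the 2 of [normc_Mop_le] times the 2 of the hypothesis on [a], [b], [c]. *)
pose M := 4 `^ q * (2 + K ^+ 3).
have M0 : 0 <= M by rewrite mulr_ge0 ?powR_ge0// addr_ge0// exprn_ge0.
apply: (@Mop_bounded_ball p q (M `^ q^-1)) => //; first exact: ltW.
  exact: powR_ge0.
move=> f Lf; have /cLfunP[mf _] := Lf.
rewrite (@cLnorm_le _ _ _ mu p f 1)// powR1 => f1.
rewrite cLnorm_le ?powR_ge0// -powRrM mulVf ?gt_eqF// powRr1//.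
pose phi y := normc (f y).
have phi0 y : 0 <= phi y by exact: normc_ge0.
have mphi : measurable_fun setT phi by exact: measurable_normc.
have iphi : mu.-integrable setT (EFin \o phi).
  exact: (cLfun_normc_integrable (ltW p1) Lf).
pose v y := phi y `^ (p / 2).
pose w y := phi y `^ p.
have mv : measurable_fun setT v by exact: (measurableT_comp (measurable_powR _)).
have mw : measurable_fun setT w by exact: (measurableT_comp (measurable_powR _)).
have v0 y : 0 <= v y by exact: powR_ge0.
have w0 y : 0 <= w y by exact: powR_ge0.
have iw : mu.-integrable setT (EFin \o w).
  apply/integrableP; split; first exact/measurable_EFinP.
  under eq_integral do rewrite gee0_abs ?lee_fin ?w0//.
  by rewrite (le_lt_trans f1)// ltry.
have normv y : normc ((v y)%:C)%C = v y by rewrite normc_real ger0_norm.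
have N2v : (cLnorm mu 2%:E (fun y => ((v y)%:C)%C) <= 1)%E.
  rewrite (@cLnorm_le _ _ _ mu 2 _ 1)// powR1.
  under eq_integral do rewrite normv -powRrM divfK//.
  exact: f1.
have Lv : cLfun mu 2%:E (fun y => ((v y)%:C)%C).
  apply/cLfunP; split; first exact: cmeas_real.
  by rewrite (le_lt_trans N2v)// ltry.
have iv : mu.-integrable setT (EFin \o v).
  have := cLfun_normc_integrable (ler1n R 2) Lv.
  by under [X in EFin \o X]eq_fun do rewrite normv.
have G3 : (\int[mu]_x ((kavg P v x) ^+ 3)%:E <= (K ^+ 3)%:E)%E.
  have : (cLnorm mu 3%:E (Mop P (fun y => ((v y)%:C)%C)) <= K%:E)%E.
    apply: le_trans (PK _ Lv) _.
    by rewrite -[leRHS]mule1 lee_wpmul2l ?lee_fin.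
  rewrite cLnorm_le// Mop_real powR_mulrn//.
  under eq_integral do
    rewrite normc_real ger0_norm ?kavg_ge0// powR_mulrn ?kavg_ge0//.
  by [].
have ikw := kavg_integrable biP iw.
have F1 : (\int[mu]_x (kavg P w x)%:E <= 1)%E.
  apply: le_trans _ f1; rewrite -[leRHS]fineK ?integrable_fin_num//.
  rewrite -[leLHS]fineK ?integrable_fin_num//.
  by have := integral_kavg biP iw; rewrite /Rintegral => ->.
have mkv : measurable_fun setT (fun x => kavg P v x ^+ 3).
  by apply: measurable_funX; exact: measurable_kavg.
have mkw : measurable_fun setT (kavg P w) by exact: measurable_kavg.
have mA : measurable_fun setT (fun x => 1 + kavg P w x + kavg P v x ^+ 3).
  by apply: measurable_funD => //; exact: measurable_funD.
have A0 x : 0 <= 1 + kavg P w x + kavg P v x ^+ 3.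
  by rewrite !addr_ge0 ?exprn_ge0 ?kavg_ge0.
have IA : (\int[mu]_x (1 + kavg P w x + kavg P v x ^+ 3)%:E <=
    (2 + K ^+ 3)%:E)%E.
  under eq_integral do rewrite EFinD.
  rewrite ge0_integralD//; last 4 first.
  - by move=> x _; rewrite lee_fin addr_ge0// kavg_ge0.
  - by apply/measurable_EFinP; exact: measurable_funD.
  - by move=> x _; rewrite lee_fin exprn_ge0// kavg_ge0.
  - exact/measurable_EFinP.
  rewrite EFinD leeD//.
  under eq_integral do rewrite EFinD.
  rewrite ge0_integralD//; last 2 first.
  - by move=> x _; rewrite lee_fin kavg_ge0.
  - exact/measurable_EFinP.
  rewrite integral_cst_mass1; last exact: probability_setT.
  by rewrite [2]mulr2n EFinD leeD.
apply: (@le_trans _ _ (\int[mu]_x ((4 `^ q)%:E *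
    (1 + kavg P w x + kavg P v x ^+ 3)%:E))%E); last first.
  rewrite ge0_integralZl_EFin ?powR_ge0//; last 2 first.
  - by move=> x _; rewrite lee_fin.
  - exact/measurable_EFinP.
  by rewrite /M EFinM lee_wpmul2l ?lee_fin ?powR_ge0.
apply: ae_ge0_le_integral => //.
- by move=> x _; rewrite lee_fin powR_ge0.
- by apply: measurable_normc_powR; exact: cmeas_Mop.
- by move=> x _; rewrite -EFinM lee_fin mulr_ge0 ?powR_ge0.
- by apply: measurable_funeM; exact/measurable_EFinP.
apply: filterS (filterI (normc_Mop_le biP mf iphi)
  (filterI (ae_kernel_integrable biP iphi)
  (filterI (ae_kernel_integrable biP iv) (ae_kernel_integrable biP iw)))).
move=> x [Pf [iphix [ivx iwx]]] _.
rewrite -EFinM lee_fin; set A := (1 + _ + _).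
have [a [b [c [tle abc]]]] :=
  ineq _ _ (kavg_ge0 x w0) (kavg_ge0 x v0).
have phile : kavg P phi x <= 2 * A `^ q^-1.
  apply: le_trans _ abc.
  have E : a + b * kavg P v x + c * kavg P w x =
      (\int[P x]_y (a + b * v y + c * w y))%R.
    have ic : (P x).-integrable setT (EFin \o (fun=> a)).
      by apply: integrable_cst_mass1; exact: prob_kernel.
    have ib := integrableZ b ivx; have icw := integrableZ c iwx.
    rewrite RintegralD//; last first.
      exact: (integrableD measurableT ic ib).
    rewrite RintegralD// !RintegralZl//; congr (_ + _ + _).
    by rewrite /Rintegral integral_cst_mass1 ?prob_kernel.
  rewrite E; apply: le_Rintegral => //.
    have ic : (P x).-integrable setT (EFin \o (fun=> a)).
      by apply: integrable_cst_mass1; exact: prob_kernel.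
    have ib := integrableZ b ivx; have icw := integrableZ c iwx.
    exact: (integrableD measurableT (integrableD measurableT ic ib) icw).
  by move=> y _; exact: tle.
have -> : 4 `^ q * A = (4 * A `^ q^-1) `^ q.
  by rewrite powRM ?powR_ge0// -powRrM mulVf ?gt_eqF// powRr1// /A.
apply: ge0_ler_powR; rewrite ?(ltW q0)// ?nnegrE ?normc_ge0 ?mulr_ge0 ?powR_ge0//.
apply: le_trans Pf _.
by rewrite (_ : 4 * _ = 2 * (2 * A `^ q^-1)) ?ler_wpM2l// mulrA -natrM.
Qed.

(** The exponent 3p/2 is the Riesz-Thorin exponent between L^2 to L^3 and the contraction of
    L^oo. *)
Lemma Mop_bounded_ge2 p : 2 <= p -> Mop_bounded mu P 2 3 ->
  Mop_bounded mu P p (3 / 2 * p).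
Proof.
move=> p2 b23; have p0 : 0 < p by rewrite (lt_le_trans _ p2).
have p1 : 1 < p by rewrite (lt_le_trans _ p2)// ltr1n.
have hp0 : 0 < p / 2 by rewrite divr_gt0.
apply: Mop_bounded_interpolation => //; first by rewrite mulr_gt0// divr_gt0.
move=> F G F0 G0; set A := 1 + F + G ^+ 3.
have A0 : 0 < A by rewrite /A -addrA ltr_pwDl// addr_ge0// exprn_ge0.
set Q := (3 / 2 * p)^-1; set K := A `^ Q.
have K0 : 0 < K by exact: powR_gt0.
(* Values below the height [K] are bounded by [K]. Above it, t^(1 - p/2) <= K^(1 - p/2), the
   exponent being nonpositive. As G <= A^(1/3), taking K = A^(1/q) makes both contributions at most
   [K]. *)
exists K, (K `^ (1 - p / 2)), 0; split.
  move=> t t0; rewrite mul0r addr0; have [tK|Kt] := leP t K.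
    by rewrite ler_wpDr// mulr_ge0 ?powR_ge0.
  have t00 : 0 < t by exact: lt_trans Kt.
  rewrite ler_wpDl ?(ltW K0)// -[leLHS](@powRr1 _ t)//.
  rewrite -{1}(subrK (p / 2) 1) powRD; last by apply/implyP => _; rewrite gt_eqF.
  rewrite ler_wpM2r ?powR_ge0// -!(opprB (p / 2)) !powRN lef_pV2 ?posrE ?powR_gt0//.
  rewrite ge0_ler_powR ?nnegrE ?(ltW K0) ?(ltW Kt)// subr_ge0.
  by rewrite ler_pdivlMr// mul1r.
have GA : G <= A `^ 3^-1.
  rewrite -[leLHS](@powRr1 _ G)// -[X in G `^ X](@mulfV _ 3)// powRrM powR_mulrn//.
  rewrite ge0_ler_powR// ?nnegrE ?(ltW A0) ?exprn_ge0//.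
  by rewrite /A lerDr addr_ge0.
rewrite mul0r addr0 mulr_natl mulr2n lerD2l.
apply: (@le_trans _ _ (K `^ (1 - p / 2) * A `^ 3^-1)).
  by rewrite ler_wpM2l ?powR_ge0.
rewrite /K -powRrM -powRD; last by apply/implyP => _; rewrite gt_eqF.
rewrite (_ : Q * (1 - p / 2) + 3^-1 = Q)// /Q.
by field; rewrite gt_eqF.
Qed.

(** The exponent q = 3p/(4 - p) is the Riesz-Thorin exponent between the contraction of L^1 and L^2
    to L^3: 1/p = 1 - t/2 and 1/q = 1 - 2t/3 with t = 2(1 - 1/p). *)
Lemma Mop_bounded_le2 p : 1 < p <= 2 -> Mop_bounded mu P 2 3 ->
  Mop_bounded mu P p (3 * p / (4 - p)).
Proof.
move=> /andP[p1 p2] b23; have p0 : 0 < p by rewrite (lt_trans _ p1).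
have p40 : 0 < 4 - p by rewrite subr_gt0 (le_lt_trans p2)// ltr_nat.
apply: Mop_bounded_interpolation => //; first by rewrite divr_gt0// mulr_gt0.
move=> F G F0 G0; set A := 1 + F + G ^+ 3.
have A0 : 0 < A by rewrite /A -addrA ltr_pwDl// addr_ge0// exprn_ge0.
set Q := (3 * p / (4 - p))^-1; set K := A `^ (4 / (3 * p)).
have K0 : 0 < K by exact: powR_gt0.
(* Below the height [K] the bound is by t^(p/2), above it by t^p. The height A^(4/(3p)) balances the
   two contributions K^(1 - p/2) A^(1/3) and K^(1 - p) A, both equal to A^(1/q). *)
exists 0, (K `^ (1 - p / 2)), (K `^ (1 - p)); split.
  move=> t; rewrite le_eqVlt => /predU1P[<-|t0].
    by rewrite add0r addr_ge0 ?mulr_ge0 ?powR_ge0.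
  rewrite add0r; have [tK|Kt] := leP t K.
    rewrite ler_wpDr ?mulr_ge0 ?powR_ge0//.
    rewrite -[leLHS](@powRr1 _ t) ?(ltW t0)//.
    rewrite -{1}(subrK (p / 2) 1) powRD; last by apply/implyP => _; rewrite gt_eqF.
    rewrite ler_wpM2r ?powR_ge0// ge0_ler_powR ?nnegrE ?(ltW K0) ?(ltW t0)//.
    by rewrite subr_ge0 ler_pdivrMr// mul1r.
  rewrite ler_wpDl ?mulr_ge0 ?powR_ge0// -[leLHS](@powRr1 _ t) ?(ltW t0)//.
  rewrite -{1}(subrK p 1) powRD; last by apply/implyP => _; rewrite gt_eqF.
  rewrite ler_wpM2r ?powR_ge0// -!(opprB p) !powRN lef_pV2 ?posrE ?powR_gt0//.
  by rewrite ge0_ler_powR ?nnegrE ?(ltW K0) ?(ltW Kt) ?(ltW t0)// subr_ge0 ltW.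
have GA : G <= A `^ 3^-1.
  rewrite -[leLHS](@powRr1 _ G)// -[X in G `^ X](@mulfV _ 3)// powRrM powR_mulrn//.
  rewrite ge0_ler_powR// ?nnegrE ?(ltW A0) ?exprn_ge0//.
  by rewrite /A lerDr addr_ge0.
have FA : F <= A `^ 1.
  by rewrite powRr1 ?(ltW A0)// /A addrAC lerDr addr_ge0// exprn_ge0.
rewrite add0r mulr_natl mulr2n lerD//.
  apply: (@le_trans _ _ (K `^ (1 - p / 2) * A `^ 3^-1)).
    by rewrite ler_wpM2l ?powR_ge0.
  rewrite /K -powRrM -powRD; last by apply/implyP => _; rewrite gt_eqF.
  rewrite (_ : _ * (1 - p / 2) + 3^-1 = Q)// /Q.
  by field; rewrite !gt_eqF.
apply: (@le_trans _ _ (K `^ (1 - p) * A `^ 1)).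
  by rewrite ler_wpM2l ?powR_ge0.
rewrite /K -powRrM -powRD; last by apply/implyP => _; rewrite gt_eqF.
rewrite (_ : _ * (1 - p) + 1 = Q)// /Q.
by field; rewrite !gt_eqF.
Qed.

End bounds.

(** * Contraction of the functions of mean 0 in L^2 *)

(** Equality holds for |x| <= 1; for x > 1 the difference of the two sides is 2 (x - 1)^3. *)
Lemma cube_sum_ge (R : realType) (x : R) :
  2 + 6 * x ^+ 2 <= `|1 + x| ^+ 3 + `|1 - x| ^+ 3.
Proof.
wlog x0 : x / 0 <= x.
  move=> H; have [/H//|xlt0] := leP 0 x.
  have := H (- x); rewrite oppr_ge0 (ltW xlt0) => /(_ isT).
  by rewrite sqrrN opprK [leRHS]addrC.
rewrite (ger0_norm (_ : 0 <= 1 + x)) ?addr_ge0//.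
have [x1|x1] := leP x 1.
  by rewrite ger0_norm ?subr_ge0// le_eqVlt; apply/orP; left; apply/eqP; ring.
rewrite ltr0_norm ?subr_lt0//.
have : 0 <= (x - 1) ^+ 3 by rewrite exprn_ge0// subr_ge0 ltW.
nra.
Qed.

Section spectral_gap.
Context {R : realType} {d : measure_display} {S : measurableType d}.
Variable mu : probability S R.
Variable P : R.-pker S ~> S.
Hypothesis biP : bistochastic mu P.
Implicit Types (f g : S -> R[i]) (c l : R[i]) (u v : S -> R).

Lemma real_L2 u (m : R) : measurable_fun setT u ->
  (\int[mu]_x (u x ^+ 2)%:E <= m%:E)%E ->
  cLfun mu 2%:E (fun x => ((u x)%:C)%C).
Proof.
move=> mu_ um; apply/cLfunP; split; first exact: cmeas_real.
apply/cLnorm_lty => //; apply: le_lt_trans (ltry m); apply: le_trans um.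
under eq_integral do
  rewrite normc_real powR_mulrn// real_normK ?num_real//.
by [].
Qed.

Lemma real_L2_integrable u (m : R) : measurable_fun setT u ->
  (\int[mu]_x (u x ^+ 2)%:E <= m%:E)%E -> mu.-integrable setT (EFin \o u).
Proof.
move=> mu_ um.
by have [] := cLfun_cintegrable (ler1n R 2) (real_L2 mu_ um).
Qed.

Variable K : R.
Hypothesis K0 : 0 <= K.
Hypothesis PK : forall f, cLfun mu 2%:E f ->
  (cLnorm mu 3%:E (Mop P f) <= K%:E * cLnorm mu 2%:E f)%E.

(** Bounds the cube of the L^3-norm of [P (1 + u)]: when [u] has mean 0 the cross term vanishes, and
    [1 + u] has L^2-norm at most 2^(1/2). *)
Let T : R := (K * 2 `^ 2^-1) ^+ 3.

Lemma cube_kavg_le u : measurable_fun setT u ->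
  (\int[mu]_x (u x ^+ 2)%:E <= 1)%E -> (\int[mu]_x u x)%R = 0 ->
  (\int[mu]_x (`|1 + kavg P u x| ^+ 3)%:E <= T%:E)%E.
Proof.
move=> mu_ u1 u0; have iu := real_L2_integrable mu_ u1.
have iu2 : mu.-integrable setT (EFin \o (fun x => u x ^+ 2)).
  apply/integrableP; split; first exact/measurable_EFinP/measurable_funX.
  under eq_integral do rewrite gee0_abs ?lee_fin ?sqr_ge0//.
  by rewrite (le_lt_trans u1)// ltry.
have ic : mu.-integrable setT (EFin \o (fun=> (1 : R))).
  by apply: integrable_cst_mass1; exact: probability_setT.
have mv : measurable_fun setT (fun x => 1 + u x) by exact: measurable_funD.
have v2 : (\int[mu]_x ((1 + u x) ^+ 2)%:E <= 2%:E)%E.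
  have E x : ((1 + u x) ^+ 2)%:E = ((1 + u x ^+ 2) + 2 * u x)%:E.
    by congr (_%:E); ring.
  under eq_integral do rewrite E.
  have i1 := integrableD measurableT ic iu2.
  have i2 := integrableZ 2 iu.
  have -> : (\int[mu]_x (1 + u x ^+ 2 + 2 * u x)%:E =
      \int[mu]_x (1 + u x ^+ 2)%:E + \int[mu]_x (2 * u x)%:E)%E.
    exact: (integralD measurableT i1 i2).
  have -> : (\int[mu]_x (2 * u x)%:E = 0)%E.
    rewrite -[LHS]fineK ?integrable_fin_num//.
    by have := RintegralZl 2 measurableT iu; rewrite u0 mulr0 /Rintegral => ->.
  have -> : (\int[mu]_x (1 + u x ^+ 2)%:E = 1 + \int[mu]_x (u x ^+ 2)%:E)%E.
    rewrite -[X in (X + _)%E](integral_cst_mass1 1 (probability_setT mu)).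
    exact: (integralD measurableT ic iu2).
  by rewrite adde0 [2]mulr2n EFinD leeD2l.
have Lv := real_L2 mv v2.
have := PK Lv.
have N2 : (cLnorm mu 2%:E (fun x => ((1 + u x)%:C)%C) <= (2 `^ 2^-1)%:E)%E.
  rewrite cLnorm_le ?powR_ge0// -powRrM mulVf// powRr1//.
  under eq_integral do
    rewrite normc_real powR_mulrn// real_normK ?num_real//.
  exact: v2.
move=> /le_trans/(_ (lee_wpmul2l _ N2)); rewrite lee_fin K0 => /(_ isT).
rewrite -EFinM cLnorm_le ?mulr_ge0 ?powR_ge0// powR_mulrn ?mulr_ge0 ?powR_ge0//.
move=> h; apply: le_trans h; rewrite Mop_real.
have mk := measurable_kavg P mu_.
have mk1 := measurable_kavg P mv.
apply: ae_ge0_le_integral => //.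
- apply/measurable_EFinP/measurable_funX; apply: measurableT_comp => //.
  exact: measurable_funD.
- by move=> x _; rewrite lee_fin powR_ge0.
- by apply: measurable_normc_powR; exact: cmeas_real.
apply: filterS (ae_kernel_integrable biP iu) => x iux _.
rewrite normc_real powR_mulrn// lee_fin /kavg RintegralD//.
  by rewrite {2}/Rintegral integral_cst_mass1 ?prob_kernel.
by apply: integrable_cst_mass1; exact: prob_kernel.
Qed.

Lemma kavg_gap_unit u : measurable_fun setT u ->
  (\int[mu]_x (u x ^+ 2)%:E <= 1)%E -> (\int[mu]_x u x)%R = 0 ->
  (\int[mu]_x (kavg P u x ^+ 2)%:E <= ((T - 1) / 3)%:E)%E.
Proof.
move=> mu_ u1 u0; have iu := real_L2_integrable mu_ u1.
have mN : measurable_fun setT (fun x => -1 * u x) by exact: measurable_funM.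
have h1 := cube_kavg_le mu_ u1 u0.
have h2 : (\int[mu]_x (`|1 + kavg P (fun x => (-1 * u x)%R) x| ^+ 3)%:E <= T%:E)%E.
  apply: cube_kavg_le => //.
    by under eq_integral do rewrite mulN1r sqrrN.
  by rewrite RintegralZl// u0 mulr0.
have mk := measurable_kavg P mu_; have mkN := measurable_kavg P mN.
have m2 : measurable_fun setT (EFin \o (fun x => kavg P u x ^+ 2)).
  exact/measurable_EFinP/measurable_funX.
have m31 : measurable_fun setT (fun x => (`|1 + kavg P u x| ^+ 3)%:E).
  apply/measurable_EFinP/measurable_funX; apply: measurableT_comp => //.
  exact: measurable_funD.
have m32 : measurable_fun setT
    (fun x => (`|1 + kavg P (fun x => (-1 * u x)%R) x| ^+ 3)%:E).
  apply/measurable_EFinP/measurable_funX; apply: measurableT_comp => //.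
  exact: measurable_funD.
have := leeD h1 h2; rewrite -ge0_integralD//.
have : (\int[mu]_x (2%:E + 6%:E * (kavg P u x ^+ 2)%:E) <=
    \int[mu]_x ((`|1 + kavg P u x| ^+ 3)%:E +
      (`|1 + kavg P (fun x => (-1 * u x)%R) x| ^+ 3)%:E))%E.
  apply: ae_ge0_le_integral => //.
  - by move=> x _; rewrite -EFinM -EFinD lee_fin addr_ge0// mulr_ge0// sqr_ge0.
  - by apply: emeasurable_funD => //; exact: measurable_funeM.
  - by move=> x _; rewrite -EFinD lee_fin addr_ge0// exprn_ge0.
  - exact: emeasurable_funD.
  apply: filterS (ae_kernel_integrable biP iu) => x iux _.
  rewrite -EFinM -!EFinD lee_fin.
  by rewrite {3}/kavg RintegralZl// mulN1r; exact: cube_sum_ge.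
have -> : (\int[mu]_x (2%:E + 6%:E * (kavg P u x ^+ 2)%:E) =
    2%:E + 6%:E * \int[mu]_x (kavg P u x ^+ 2)%:E)%E.
  rewrite ge0_integralD//; last 2 first.
  - by move=> x _; rewrite -EFinM lee_fin mulr_ge0// sqr_ge0.
  - exact: measurable_funeM.
  rewrite integral_cst_mass1; last exact: probability_setT.
  by rewrite ge0_integralZl_EFin// => x _; rewrite lee_fin sqr_ge0.
move=> /le_trans /[apply]; rewrite -EFinD => h.
(* Finiteness has to precede the solution of [h] as an inequality between reals; it follows from [h]
   itself. *)
have fink : (\int[mu]_x (kavg P u x ^+ 2)%:E)%E \is a fin_num.
  rewrite ge0_fin_numE; last first.
    by apply: integral_ge0 => x _; rewrite lee_fin sqr_ge0.
  rewrite ltey; apply/eqP => koo; move: h.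
  by rewrite koo gt0_muley ?lte_fin// addey// leye_eq.
move: h; rewrite -(fineK fink) -EFinM -EFinD !lee_fin.
lra.
Qed.

Lemma kavg_gap u (m : R) : 0 <= T - 1 -> measurable_fun setT u ->
  (\int[mu]_x (u x ^+ 2)%:E <= m%:E)%E -> (\int[mu]_x u x)%R = 0 ->
  (\int[mu]_x (kavg P u x ^+ 2)%:E <= ((T - 1) / 3 * m)%:E)%E.
Proof.
move=> T1 mu_ um u0; have iu := real_L2_integrable mu_ um.
have m0 : 0 <= m.
  by rewrite -lee_fin (le_trans _ um)// integral_ge0// => x _; rewrite lee_fin sqr_ge0.
have r0 : 0 <= (T - 1) / 3 by rewrite divr_ge0.
apply/lee_addgt0Pr => e e0.
(* Rescaling to the unit ball; since [m] may be 0, [u] is divided by the square root of a larger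
   [b], at a cost of at most [e]. *)
pose b := m + e / ((T - 1) / 3 + 1).
have r1 : 0 < (T - 1) / 3 + 1 by rewrite ltr_wpDl.
have b0 : 0 < b by rewrite ltr_wpDl// divr_gt0.
pose a := Num.sqrt b; have a0 : 0 < a by rewrite sqrtr_gt0.
have a2 : a ^+ 2 = b by rewrite sqr_sqrtr// ltW.
have mv : measurable_fun setT (fun x => a^-1 * u x) by exact: measurable_funM.
have sqrE (w : S -> R) : measurable_fun setT w ->
    (\int[mu]_x ((a^-1 * w x) ^+ 2)%:E = b^-1%:E * \int[mu]_x (w x ^+ 2)%:E)%E.
  move=> mw; under eq_integral do rewrite exprMn exprVn a2 EFinM.
  rewrite ge0_integralZl_EFin ?invr_ge0 ?(ltW b0)//.
  - by move=> x _; rewrite lee_fin sqr_ge0.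
  - exact/measurable_EFinP/measurable_funX.
have /kavg_gap_unit : measurable_fun setT (fun x => a^-1 * u x) by [].
have v1 : (\int[mu]_x ((a^-1 * u x) ^+ 2)%:E <= 1)%E.
  rewrite sqrE// lee_pdivrMl// mule1 (le_trans um)// lee_fin lerDl.
  by rewrite divr_ge0// ltW.
have v0 : (\int[mu]_x (a^-1 * u x))%R = 0 by rewrite RintegralZl// u0 mulr0.
move=> /(_ v1 v0).
rewrite (ae_eq_integral (fun x => ((a^-1 * kavg P u x) ^+ 2)%:E))//.
- rewrite sqrE; last exact: measurable_kavg.
  rewrite lee_pdivrMl// -EFinM => /le_trans; apply.
  rewrite -EFinD lee_fin mulrC /b mulrDr lerD2l.
  by rewrite mulrA ler_pdivrMr// mulrC ler_wpM2l ?(ltW e0)// lerDl.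
- exact/measurable_EFinP/measurable_funX/measurable_kavg.
- apply/measurable_EFinP/measurable_funX; apply: measurable_funM => //.
  exact: measurable_kavg.
apply: filterS (ae_kernel_integrable biP iu) => x iux _.
by rewrite {1}/kavg RintegralZl.
Qed.

End spectral_gap.

(** * Series dominated in L^2 *)

Section dominated_series.
Context {R : realType} {d : measure_display} {S : measurableType d}.
Variable mu : probability S R.

(* [h^2] is the sum of the [sigma^-k v_k^2], with [rho < sigma < 1], and
   [tau^2 = sigma]. *)
Lemma geometric_L2_dominated (v_ : nat -> S -> R) (M rho : R) :
  0 < rho < 1 -> 0 <= M -> (forall k, measurable_fun setT (v_ k)) ->
  (forall k, \int[mu]_x (v_ k x ^+ 2)%:E <= (M * rho ^+ k)%:E)%E ->
  exists (h : S -> R) (B tau : R),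
    [/\ measurable_fun setT h, forall x, 0 <= h x, 0 < tau < 1,
        (\int[mu]_x (h x ^+ 2)%:E <= B%:E)%E &
        {ae mu, forall x, forall k, `|v_ k x| <= h x * tau ^+ k}].
Proof.
move=> /andP[r0 r1] M0 mv vM.
pose s : R := (1 + rho) / 2.
have s0 : 0 < s by rewrite divr_gt0// addr_gt0.
have s1 : s < 1 by rewrite ltr_pdivrMr// mul1r [ltRHS]mulr2n ltrD2l.
have rs : rho < s by rewrite ltr_pdivlMr// mulr_natr mulr2n ltrD2r.
pose g k x : \bar R := (s ^- k * v_ k x ^+ 2)%:E.
have g0 k x : (0 <= g k x)%E.
  by rewrite lee_fin mulr_ge0 ?sqr_ge0// invr_ge0 exprn_ge0// ltW.
have mg k : measurable_fun setT (g k).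
  by apply/measurable_EFinP/measurable_funM => //; exact: measurable_funX.
pose H x := (\sum_(0 <= k <oo) g k x)%E.
have H0 x : (0 <= H x)%E by apply: nneseries_ge0.
have mH : measurable_fun setT H by apply: ge0_emeasurable_sum.
pose z := rho / s.
have z0 : 0 < z by rewrite divr_gt0.
have z1 : `|z| < 1 by rewrite gtr0_norm// ltr_pdivrMr// mul1r.
pose B := M / (1 - z).
have IH : (\int[mu]_x H x <= B%:E)%E.
  rewrite integral_nneseries//; apply: lime_le.
    by apply: is_cvg_nneseries => n _ _; exact: integral_ge0.
  apply: nearW => n; apply: (@le_trans _ _ (series (geometric M z) n)%:E).
    rewrite /series/= -sumEFin lee_sum// => k _.
    rewrite /g; under eq_integral do rewrite EFinM.
    rewrite ge0_integralZl_EFin//; last 3 first.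
    - by move=> x _; rewrite lee_fin sqr_ge0.
    - exact/measurable_EFinP/measurable_funX.
    - by rewrite invr_ge0 exprn_ge0// ltW.
    rewrite lee_pdivrMl ?exprn_gt0// -EFinM (le_trans (vM k))// lee_fin.
    by rewrite mulrCA -exprMn /z mulrCA mulfV ?mulr1// gt_eqF.
  by rewrite lee_fin geometric_le_lim.
have Hfin : {ae mu, forall x, H x \is a fin_num}.
  have iH : mu.-integrable setT H.
    apply/integrableP; split => //.
    under eq_integral do rewrite gee0_abs//.
    by rewrite (le_lt_trans IH)// ltry.
  by apply: filterS (integrable_ae measurableT iH) => x /(_ I).
exists (fun x => (fine (H x)) `^ 2^-1), B, (s `^ 2^-1); split.
- by apply: (measurableT_comp (measurable_powR _)); exact: measurableT_comp.
- by move=> x; exact: powR_ge0.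
- have h2 : (0 : R) < 2^-1 by rewrite invr_gt0.
  have := @gt0_ltr_powR R _ h2 s 1.
  by rewrite !nnegrE powR1 (ltW s0) ler01 powR_gt0//= => ->.
- apply: le_trans IH; apply: ge0_le_integral => //.
  + by move=> x _; rewrite lee_fin sqr_ge0.
  + apply/measurable_EFinP/measurable_funX.
    by apply: (measurableT_comp (measurable_powR _)); exact: measurableT_comp.
  move=> x _; rewrite powR12_sqrt ?fine_ge0// sqr_sqrtr ?fine_ge0//.
  by have := H0 x; case: (H x) => //= r; rewrite ?leey.
apply: filterS Hfin => x Hx k.
rewrite !powR12_sqrt ?fine_ge0 ?(ltW s0)//.
rewrite -[leRHS]ger0_norm; last by rewrite mulr_ge0 ?exprn_ge0 ?sqrtr_ge0.
rewrite -ler_sqr ?nnegrE// !real_normK ?num_real// exprMn.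
rewrite -exprM mulnC exprM !sqr_sqrtr ?fine_ge0 ?(ltW s0)//.
rewrite -ler_pdivrMr ?exprn_gt0// mulrC -lee_fin fineK//.
(* After squaring, the claim is that a single term [g k x] of a nonnegative series is at most its
   sum [H x]. *)
have := @nneseries_lim_ge R (g ^~ x) xpredT 0%N k.+1 (fun n _ _ => g0 n x).
apply: le_trans; rewrite big_mkcond/= big_nat_recr//= leeDr//.
by apply: sume_ge0 => n _.
Qed.

Variable P : R.-pker S ~> S.
Hypothesis biP : bistochastic mu P.

(** The partial sums are bounded by [h / (1 - tau)]. By [ae_kernel] the same domination holds
    [P x]-almost everywhere for almost every [x], and dominated convergence under [P x] exchanges
    the average and the sum. *)
Lemma dominated_series_sum (u_ : nat -> S -> R) (h : S -> R) (tau : R) :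
  (forall k, measurable_fun setT (u_ k)) ->
  (forall k, mu.-integrable setT (EFin \o u_ k)) ->
  (forall x, 0 <= h x) -> mu.-integrable setT (EFin \o h) -> 0 < tau < 1 ->
  {ae mu, forall x, forall k, `|u_ k x| <= h x * tau ^+ k} ->
  exists U : S -> R,
    [/\ measurable_fun setT U,
        {ae mu, forall x, series (u_ ^~ x) @ \oo --> U x},
        {ae mu, forall x, `|U x| <= h x / (1 - tau)} &
        {ae mu, forall x, series (fun k => kavg P (u_ k) x) @ \oo --> kavg P U x}].
Proof.
move=> mu_ iu h0 ih /andP[t0 t1] uh.
have t1' : `|tau| < 1 by rewrite gtr0_norm.
(* An upper limit is measurable on the whole space, including the null set where the series may
   diverge. *)
pose U x := fine (limn_esup (fun n => (series (u_ ^~ x) n)%:E)).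
have mser n : measurable_fun setT (fun x => (series (u_ ^~ x) n)%:E).
  by apply/measurable_EFinP; apply: measurable_sum.
have mU : measurable_fun setT U.
  by apply: (measurableT_comp (f := fine)) => //; exact: measurable_fun_limn_esup.
have good x : (forall k, `|u_ k x| <= h x * tau ^+ k) ->
    series (u_ ^~ x) @ \oo --> U x /\
    forall n, `|series (u_ ^~ x) n| <= h x / (1 - tau).
  move=> ux.
  have cv : cvgn (series (u_ ^~ x)).
    apply: normed_cvg.
    apply: (@series_le_cvg _ (fun k => `|u_ k x|) (geometric (h x) tau)) => //.
      by move=> n; rewrite /= mulr_ge0// exprn_ge0// ltW.
    exact: is_cvg_geometric_series.
  split.
    have /cvg_limn_einf_sup[_ E] : (series (u_ ^~ x) n)%:E @[n --> \oo] -->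
        (limn (series (u_ ^~ x)))%:E.
      by apply: cvg_EFin; [exact: nearW|exact: cv].
    by rewrite /U E.
  move=> n; apply: le_trans (geometric_le_lim n (h0 x) t0 t1').
  apply: le_trans (ler_norm_sum _ _ _) _.
  by apply: ler_sum => k _; exact: ux.
exists U; split => //.
- by apply: filterS uh => x /good[].
- apply: filterS uh => x /good[cv ub].
  rewrite -(cvg_lim (@Rhausdorff R) (cvg_norm cv)); apply: limr_le.
    by apply/cvg_ex; eexists; exact: cvg_norm cv.
  by apply: nearW => n; exact: ub.
have iux : {ae mu, forall x, forall k, (P x).-integrable setT (EFin \o u_ k)}.
  by apply: ae_foralln => k; exact: ae_kernel_integrable.
apply: filterS3 (ae_kernel biP uh) (ae_kernel_integrable biP ih) iux => x Px ihx iux.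
have ig : (P x).-integrable setT (EFin \o (fun y => (1 - tau)^-1 * h y)).
  exact: integrableZ.
have [] := @dominated_convergence _ _ _ (P x) _ measurableT
  (fun n y => (series (u_ ^~ y) n)%:E) (EFin \o U)
  (EFin \o (fun y => (1 - tau)^-1 * h y)) mser _ _ ig _.
- exact/measurable_EFinP.
- by apply: filterS Px => y /good[cv _] _; apply: cvg_EFin; [exact: nearW|].
- apply: filterS Px => y /good[_ ub] n _.
  by rewrite /= lee_fin mulrC.
move=> iU _ cvI.
have E n : (\int[P x]_y (series (u_ ^~ y) n)%:E =
    (series (fun k => kavg P (u_ k) x) n)%:E)%E.
  rewrite /series/=; under eq_integral do rewrite -sumEFin.
  rewrite integral_sum//= -sumEFin; apply: eq_bigr => k _.
  by rewrite EFin_kavg.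
suff /fine_cvg : (series (fun k => kavg P (u_ k) x) n)%:E @[n --> \oo] -->
  (kavg P U x)%:E by [].
rewrite (EFin_kavg iU); apply: cvg_trans cvI.
by apply: near_eq_cvg; apply: nearW => n /=; rewrite E.
Qed.

End dominated_series.

(** * Invertibility on L^2 *)

Section L2_invertibility.
Context {R : realType} {d : measure_display} {S : measurableType d}.
Variable mu : probability S R.
Variable P : R.-pker S ~> S.
Hypothesis biP : bistochastic mu P.
Implicit Types (f g : S -> R[i]) (c l : R[i]) (u v : S -> R).

Definition cmean f : R[i] :=
  ((\int[mu]_x Re (f x)) +i* (\int[mu]_x Im (f x)))%C.

Lemma cmeanD f g : cintegrable mu f -> cintegrable mu g ->
  cmean (fun x => f x + g x) = cmean f + cmean g.
Proof.
move=> [rf jf] [rg jg]; apply: complexP; rewrite ?Re_addc ?Im_addc /=.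
  by under eq_Rintegral do rewrite Re_addc; rewrite RintegralD.
by under eq_Rintegral do rewrite Im_addc; rewrite RintegralD.
Qed.

Lemma cmeanZ c f : cintegrable mu f -> cmean (fun x => c * f x) = c * cmean f.
Proof.
move=> [rf jf]; apply: complexP; rewrite ?Re_mulc ?Im_mulc /=.
  under eq_Rintegral do rewrite Re_mulc.
  by rewrite RintegralB ?RintegralZl//; exact: integrableZ.
under eq_Rintegral do rewrite Im_mulc.
by rewrite RintegralD ?RintegralZl//; exact: integrableZ.
Qed.

Lemma cmean_cst c : cmean (cst c) = c.
Proof.
rewrite /cmean /Rintegral !integral_cst_mass1; first by case: c.
- exact: probability_setT.
- exact: probability_setT.
Qed.

Lemma cmean_Mop f : cintegrable mu f -> cmean (Mop P f) = cmean f.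
Proof. by move=> [rf jf]; rewrite /cmean !integral_kavg. Qed.

(** 4 = 2 * 2: one factor for the real and imaginary parts, one for the comparison of the L^1- and
    L^2-norms in [cLnorm_monotone]. *)
Lemma normc_cmean_le f : cLfun mu 2%:E f ->
  ((normc (cmean f))%:E <= 4%:E * cLnorm mu 2%:E f)%E.
Proof.
move=> Lf; have [rf jf] := cLfun_cintegrable (ler1n R 2) Lf.
have inf := cLfun_normc_integrable (ler1n R 2) Lf.
apply: (@le_trans _ _ (2%:E * cLnorm mu 1%:E f))%E; last first.
  rewrite (_ : 4 = 2 * 2) -?natrM// natrM EFinM -muleA lee_wpmul2l//.
  have := @cLnorm_monotone _ _ _ mu 1 2 f.
  by rewrite invr1 powRr1//; apply => //; rewrite ltr01 ler1n.
rewrite cLnormE invr1 poweRe1; last first.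
  by apply: integral_ge0 => x _; rewrite lee_fin powR_ge0.
under eq_integral do rewrite powRr1 ?normc_ge0//.
rewrite -[X in (_ * X)%E]fineK; last by apply: integrable_fin_num.
rewrite -EFinM lee_fin; apply: le_trans (normc_le_ReIm _) _ => /=.
rewrite mulr_natl mulr2n lerD//.
  apply: le_trans (le_normr_Rintegral _ rf) _ => //; apply: le_Rintegral => //.
    exact: (integrable_abse rf).
  by move=> y _; exact: normr_Re_le.
apply: le_trans (le_normr_Rintegral _ jf) _ => //; apply: le_Rintegral => //.
  exact: (integrable_abse jf).
by move=> y _; exact: normr_Im_le.
Qed.

Lemma cLnorm2_le f (s : R) : 0 <= s ->
  (cLnorm mu 2%:E f <= s%:E)%E =
  (\int[mu]_x (normc (f x) ^+ 2)%:E <= (s ^+ 2)%:E)%E.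
Proof.
move=> s0; rewrite cLnorm_le// powR_mulrn//.
by under eq_integral do rewrite powR_mulrn ?normc_ge0//.
Qed.

Lemma integral_normc2 f : cmeas f ->
  (\int[mu]_x (normc (f x) ^+ 2)%:E =
   \int[mu]_x (Re (f x) ^+ 2)%:E + \int[mu]_x (Im (f x) ^+ 2)%:E)%E.
Proof.
move=> [mr mi]; under eq_integral do rewrite sqr_normc_ReIm EFinD.
rewrite ge0_integralD//.
- by move=> x _; rewrite lee_fin sqr_ge0.
- exact/measurable_EFinP/measurable_funX.
- by move=> x _; rewrite lee_fin sqr_ge0.
- exact/measurable_EFinP/measurable_funX.
Qed.

Variable rho : R.
Hypothesis rho01 : 0 < rho < 1.
Hypothesis gap : forall u (m : R), measurable_fun setT u ->
  (\int[mu]_x (u x ^+ 2)%:E <= m%:E)%E -> (\int[mu]_x u x)%R = 0 ->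
  (\int[mu]_x (kavg P u x ^+ 2)%:E <= (rho * m)%:E)%E.

(** The real gap is applied to the two parts, whose squared norms add up exactly. A loss as in
    [normc_Mop_le] could push the factor above 1. *)
Lemma Mop_gap f (m : R) : cmeas f ->
  (\int[mu]_x (normc (f x) ^+ 2)%:E <= m%:E)%E -> cmean f = 0 ->
  (\int[mu]_x (normc (Mop P f x) ^+ 2)%:E <= (rho * m)%:E)%E.
Proof.
move=> mf fm [r0 i0]; have [mr mi] := mf.
have r_ge0 : 0 <= rho by have /andP[/ltW] := rho01.
have sq0 u : (0 <= \int[mu]_x (u x ^+ 2)%:E)%E.
  by apply: integral_ge0 => x _; rewrite lee_fin sqr_ge0.
move: fm; rewrite !integral_normc2//; last exact: cmeas_Mop.
set a := (\int[mu]_x _)%E; set b := (\int[mu]_x _)%E => abm.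
have [afin bfin] : a \is a fin_num /\ b \is a fin_num.
  rewrite !ge0_fin_numE ?sq0//; split.
    by apply: le_lt_trans (le_lt_trans abm (ltry m)); rewrite leeDl// sq0.
  by apply: le_lt_trans (le_lt_trans abm (ltry m)); rewrite leeDr// sq0.
have := leeD (gap (m := fine a) mr _ r0) (gap (m := fine b) mi _ i0).
rewrite !fineK// => /(_ (lexx _) (lexx _)) /le_trans; apply.
rewrite -EFinD -mulrDr lee_fin ler_wpM2l// -lee_fin EFinD !fineK//.
Qed.

Variable l : R[i].
Hypothesis l1 : normc l = 1.
Hypothesis ln1 : l != 1.

Let l0 : l != 0.
Proof. exact: normc1_neq0. Qed.

Let sqrt_rho : 0 <= Num.sqrt rho < 1.
Proof.
by rewrite sqrtr_ge0 /= -[ltRHS]sqrtr1 ltr_sqrt//; have /andP[] := rho01.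
Qed.

Lemma cLnorm_Mop_gap f : cLfun mu 2%:E f -> cmean f = 0 ->
  (cLnorm mu 2%:E (Mop P f) <= (Num.sqrt rho)%:E * cLnorm mu 2%:E f)%E.
Proof.
move=> /cLfunP[mf foo] f0.
have ffin : cLnorm mu 2%:E f \is a fin_num by rewrite ge0_fin_numE ?cLnorm_ge0.
rewrite -(fineK ffin); set a := fine _.
have a0 : 0 <= a by rewrite fine_ge0 ?cLnorm_ge0.
have s0 := sqrtr_ge0 rho.
rewrite -EFinM cLnorm2_le ?mulr_ge0// exprMn sqr_sqrtr; last by have /andP[/ltW] := rho01.
by apply: Mop_gap => //; rewrite -cLnorm2_le// fineK.
Qed.

Lemma cLfun2_Mop_mean0 f : cLfun mu 2%:E f -> cmean f = 0 ->
  cLfun mu 2%:E (Mop P f).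
Proof.
move=> Lf f0; have /cLfunP[mf foo] := Lf; apply/cLfunP; split.
  exact: cmeas_Mop.
by apply: le_lt_trans (cLnorm_Mop_gap Lf f0) _; rewrite lte_mul_pinfty// lee_fin sqrtr_ge0.
Qed.

Lemma cLnorm_cst p c : 0 < p -> cLnorm mu p%:E (cst c) = (normc c)%:E.
Proof.
move=> p0; rewrite cLnormE (eq_integral (fun=> (normc c `^ p)%:E))//.
rewrite integral_cst_mass1; last exact: probability_setT.
by rewrite poweR_EFin -powRrM mulfV ?gt_eqF// powRr1 ?normc_ge0.
Qed.

(** Write f = f0 + c with [c] the mean of [f], and let g = (l - P) f. As [P] preserves means, [g]
    has mean (l - 1) c, which bounds [c] by 4 |g| / |l - 1|. On [f0] the contraction gives the
    factor 1 / (1 - rho^(1/2)), and (l - P) f0 = g - (l - 1) c has norm at most (1 + 4) |g|. *)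
Lemma shifted_bounded_below2 f : Mop_bounded mu P 2 2 -> cLfun mu 2%:E f ->
  (cLnorm mu 2%:E f <=
   (5 / (1 - Num.sqrt rho) + 4 / normc (l - 1))%:E *
   cLnorm mu 2%:E (shifted P l f))%E.
Proof.
move=> b22 Lf; have /cLfunP[mf foo] := Lf.
have p12 : 1 <= 2 :> R by rewrite ler1n.
have If := cLfun_cintegrable p12 Lf.
pose g := shifted P l f; pose c := cmean f.
have gE : g = (fun x => l * f x + (- 1) * Mop P f x).
  by apply/funext => x; rewrite mulN1r.
have Lg : cLfun mu 2%:E g by exact: cLfun_shifted.
have meang : cmean g = (l - 1) * c.
  rewrite gE cmeanD ?cmeanZ ?cmean_Mop//.
  - by rewrite mulrBl mul1r mulN1r.
  - exact: cintegrable_Mop.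
  - exact: cintegrableZ.
  - by apply: cintegrableZ; exact: cintegrable_Mop.
pose f0 := fun x => f x + cst (- c) x.
have Lc a : cLfun mu 2%:E (cst a) by exact: cLfun_cst.
have Ic a : cintegrable mu (cst a) by exact: cLfun_cintegrable (Lc a).
have Lf0 : cLfun mu 2%:E f0 by exact: cLfunD.
have /cLfunP[mf0 _] := Lf0.
have mean0 : cmean f0 = 0 by rewrite cmeanD// cmean_cst subrr.
have Lh := cLfun2_Mop_mean0 Lf0 mean0; have /cLfunP[mh _] := Lh.
have Ls : cLfun mu 2%:E (shifted P l f0) by exact: cLfun_shifted.
have /cLfunP[ms _] := Ls; have /cLfunP[mg _] := Lg.
have fin h : cLfun mu 2%:E h -> exists2 a : R, 0 <= a & cLnorm mu 2%:E h = a%:E.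
  move=> /cLfunP[_ hoo]; exists (fine (cLnorm mu 2%:E h)).
    by rewrite fine_ge0 ?cLnorm_ge0.
  by rewrite fineK// ge0_fin_numE ?cLnorm_ge0.
have [a a0 fa] := fin _ Lf; have [b b0 gb] := fin _ Lg.
have [e e0 f0e] := fin _ Lf0; have [s s0 ss] := fin _ Ls.
have hcb : normc ((l - 1) * c) <= 4 * b.
  by rewrite -meang -lee_fin EFinM -gb normc_cmean_le.
have h1 : e <= s + Num.sqrt rho * e.
  rewrite -lee_fin EFinD EFinM -f0e -ss.
  apply: le_trans (leeD (lexx _) (cLnorm_Mop_gap Lf0 mean0)).
  rewrite [in leLHS](_ : f0 = (fun x => l^-1 * (shifted P l f0 x + Mop P f0 x))).
    rewrite cLnormZ//; last exact: cmeasD.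
    by rewrite Normc.normcV l1 invr1 mul1e cLnormD.
  by apply/funext => x; rewrite -fixed_point_shifted.
have h2 : s <= b + 4 * b.
  rewrite -lee_fin -ss.
  rewrite (cLnorm_eq_ae (g := fun x => g x + cst (- ((l - 1) * c)) x))//.
  - apply: le_trans (@cLnormD _ _ _ mu _ _ _ p12 mg (cmeas_cst _)) _.
    by rewrite gb cLnorm_cst// EFinD leeD2l// lee_fin normcN.
  - by apply: cmeasD => //; exact: cmeas_cst.
  apply: filterS (MopD biP If (Ic (- c))) => x.
  rewrite /g /shifted => ->; rewrite Mop_cst /f0 /=; ring.
have h3 : a <= e + normc c.
  rewrite -lee_fin EFinD -fa -f0e -(@cLnorm_cst 2 c)//.
  rewrite [in leLHS](_ : f = (fun x => f0 x + cst c x)).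
    exact: (@cLnormD _ _ _ mu _ _ _ p12 mf0 (cmeas_cst c)).
  by apply/funext => x; rewrite /f0 /= subrK.
have nl : 0 < normc (l - 1).
  rewrite lt_neqAle normc_ge0 andbT eq_sym; apply/eqP => /Normc.eq0_normc /eqP.
  by rewrite subr_eq0 (negbTE ln1).
rewrite fa gb -EFinM lee_fin; apply: le_trans h3 _; rewrite mulrDl lerD//.
  rewrite mulrAC ler_pdivlMr; last by rewrite subr_gt0; have /andP[] := sqrt_rho.
  lra.
by rewrite mulrAC ler_pdivlMr// mulrC -Normc.normcM.
Qed.

(** The term l^-(k+1) P^k g of the Neumann series of (l - P)^-1 g. *)
Fixpoint resolvent_term (g : S -> R[i]) (k : nat) : S -> R[i] :=
  if k is k'.+1 then fun x => l^-1 * Mop P (resolvent_term g k') x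
  else fun x => l^-1 * g x.

Lemma resolvent_termP g (m : R) k : cLfun mu 2%:E g ->
  (\int[mu]_x (normc (g x) ^+ 2)%:E <= m%:E)%E -> cmean g = 0 ->
  [/\ cLfun mu 2%:E (resolvent_term g k), cmean (resolvent_term g k) = 0 &
     (\int[mu]_x (normc (resolvent_term g k x) ^+ 2)%:E <= (m * rho ^+ k)%:E)%E].
Proof.
move=> Lg gm g0; have p12 : 1 <= 2 :> R by rewrite ler1n.
have nli x : normc (l^-1 * x) = normc x.
  by rewrite Normc.normcM Normc.normcV l1 invr1 mul1r.
elim: k => [|k [IH1 IH2 IH3]] /=.
  split; first exact: cLfunZ.
    by rewrite cmeanZ ?g0 ?mulr0//; exact: cLfun_cintegrable Lg.
  by under eq_integral do rewrite nli; rewrite expr0 mulr1.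
have Lk := cLfun2_Mop_mean0 IH1 IH2; have /cLfunP[mk _] := IH1.
have Ik := cLfun_cintegrable p12 IH1.
split; first exact: cLfunZ.
  by rewrite cmeanZ ?cmean_Mop ?IH2 ?mulr0//; exact: cintegrable_Mop.
under eq_integral do rewrite nli.
by rewrite exprS mulrCA; exact: Mop_gap.
Qed.

Lemma shifted_onto_mean0 g : cLfun mu 2%:E g -> cmean g = 0 ->
  exists2 f, cLfun mu 2%:E f & {ae mu, forall x, shifted P l f x = g x}.
Proof.
move=> Lg g0; have /cLfunP[mg goo] := Lg.
have p12 : 1 <= 2 :> R by rewrite ler1n.
have gfin : cLnorm mu 2%:E g \is a fin_num by rewrite ge0_fin_numE ?cLnorm_ge0.
pose m := fine (cLnorm mu 2%:E g) ^+ 2.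
have gm : (\int[mu]_x (normc (g x) ^+ 2)%:E <= m%:E)%E.
  by rewrite -cLnorm2_le ?fineK// fine_ge0 ?cLnorm_ge0.
pose w := resolvent_term g.
have w_ k := resolvent_termP k Lg gm g0.
have Lw k : cLfun mu 2%:E (w k) by have [] := w_ k.
have mw k : cmeas (w k) by have /cLfunP[] := Lw k.
have Iw k := cLfun_cintegrable p12 (Lw k).
have m0 : 0 <= m by exact: sqr_ge0.
have mnw k : measurable_fun setT (fun x => normc (w k x)) := measurable_normc (mw k).
have wm k : (\int[mu]_x (normc (w k x) ^+ 2)%:E <= (m * rho ^+ k)%:E)%E.
  by have [] := w_ k.
have [h [B [tau [mh h0 tau01 hB wh]]]] := geometric_L2_dominated rho01 m0 mnw wm.
have ih : mu.-integrable setT (EFin \o h) := real_L2_integrable mh hB.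
have [tau0 tau1] := andP tau01.
have p02 : 0 < 2 :> R by [].
have [Ur [mUr cUr bUr kUr]] := @dominated_series_sum _ _ _ mu P biP
  (fun k x => Re (w k x)) h tau (fun k => (mw k).1) (fun k => (Iw k).1) h0 ih tau01
  (filterS (fun x H k => le_trans (le_trans (normr_Re_le _) (ler_norm _)) (H k)) wh).
have [Ui [mUi cUi bUi kUi]] := @dominated_series_sum _ _ _ mu P biP
  (fun k x => Im (w k x)) h tau (fun k => (mw k).2) (fun k => (Iw k).2) h0 ih tau01
  (filterS (fun x H k => le_trans (le_trans (normr_Im_le _) (ler_norm _)) (H k)) wh).
pose f x := (Ur x +i* Ui x)%C.
have mf : cmeas f by [].
exists f.
  apply/cLfunP; split => //.
  have t1 : 0 < 1 - tau by rewrite subr_gt0.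
  have Lh := cLfunZ ((2 / (1 - tau))%:C)%C p02 (real_L2 mh hB).
  have /cLfunP[mh' hoo] := Lh; apply: le_lt_trans hoo.
  apply: cLnorm_le_ae => //.
  apply: filterS2 bUr bUi => x br bi.
  apply: le_trans (normc_le_ReIm _) _.
  rewrite Normc.normcM !normc_real (ger0_norm (h0 x)).
  have q0 : 0 <= 2 / (1 - tau) by rewrite divr_ge0 ?(ltW t1).
  rewrite (ger0_norm q0) mulrAC -mulrA mulr_natl mulr2n.
  exact: lerD br bi.
(* Applying [P] shifts the series: P f is [l] times the series without its first term, that is l (f
   - w_0), and l w_0 = g. The real and imaginary parts of the product with [l] are the two real
   combinations handled by [lin]. *)
have wS k x : Mop P (w k) x = l * w k.+1 x by rewrite /w /= mulVKf.
have lin (a b y z : R) (u v : nat -> R) : series u @ \oo --> y ->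
    series v @ \oo --> z ->
    series (fun k => a * u k.+1 + b * v k.+1) @ \oo --> a * (y - u 0%N) + b * (z - v 0%N).
  move=> uy vz.
  have shift (t : nat -> R) y' : series t @ \oo --> y' ->
      series (fun k => t k.+1) @ \oo --> y' - t 0%N.
    move=> ty; rewrite (_ : series _ = fun n => series t n.+1 - t 0%N).
      by apply: cvgB; [rewrite cvg_shiftS|exact: cvg_cst].
    by apply/funext => n; rewrite /series/= big_nat_recl// addrC addKr.
  rewrite (_ : series _ = fun n => a * series (fun k => u k.+1) n +
      b * series (fun k => v k.+1) n).
    by apply: cvgD; apply: cvgMl_tmp; exact: shift.
  by apply/funext => n; rewrite /series/= big_split/= !mulr_sumr.
apply: filterS2 (filterI cUr cUi) (filterI kUr kUi) => x [cr ci] [kr ki].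
have er : kavg P Ur x = Re l * (Ur x - Re (w 0%N x)) + - Im l * (Ui x - Im (w 0%N x)).
  apply: (cvg_unique _ kr); first exact: Rhausdorff.
  rewrite (_ : (fun k => _) = fun k => Re l * Re (w k.+1 x) + - Im l * Im (w k.+1 x)).
    exact: (lin _ _ _ _ _ _ cr ci).
  apply/funext => k; rewrite mulNr -Re_mulc -wS //.
have ei : kavg P Ui x = Re l * (Ui x - Im (w 0%N x)) + Im l * (Ur x - Re (w 0%N x)).
  apply: (cvg_unique _ ki); first exact: Rhausdorff.
  rewrite (_ : (fun k => _) = fun k => Re l * Im (w k.+1 x) + Im l * Re (w k.+1 x)).
    exact: (lin _ _ _ _ _ _ ci cr).
  apply/funext => k; rewrite -Im_mulc -wS //.
have EM : Mop P f x = l * (f x - w 0%N x).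
  case: (w 0%N x) er ei => a b er ei; apply: complexP.
    by rewrite Re_mulc /= -mulNr; exact: er.
  by rewrite Im_mulc /=; exact: ei.
by rewrite /shifted EM mulrBr opprB addrC subrK /w /= mulVKf.
Qed.

Lemma shifted_invertible2 : Mop_bounded mu P 2 2 -> shifted_invertible mu P 2 l.
Proof.
move=> b22; have p12 : 1 <= 2 :> R by rewrite ler1n.
have p02 : 0 < 2 :> R by [].
split; last first.
  exists (5 / (1 - Num.sqrt rho) + 4 / normc (l - 1)).
    rewrite addr_ge0// divr_ge0// ?normc_ge0// subr_ge0 ltW//.
    by have /andP[] := sqrt_rho.
  by move=> f; exact: shifted_bounded_below2.
move=> g Lg; pose a := cmean g.
have Lc c : cLfun mu 2%:E (cst c) by exact: cLfun_cst.
have Ic c : cintegrable mu (cst c) by exact: cLfun_cintegrable (Lc c).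
pose g0 x := g x + cst (- a) x.
have Lg0 : cLfun mu 2%:E g0 by exact: cLfunD.
have mean0 : cmean g0 = 0.
  by rewrite cmeanD// ?cmean_cst ?subrr//; exact: cLfun_cintegrable Lg.
have [f Lf fg] := shifted_onto_mean0 Lg0 mean0.
(* [l - P] multiplies constants by l - 1, so this constant is the preimage of the mean [a] of
   [g]. *)
exists (fun x => f x + cst (a / (l - 1)) x); first exact: cLfunD.
have ln0 : l - 1 != 0 by rewrite subr_eq0.
apply: filterS2 fg (MopD biP (cLfun_cintegrable p12 Lf) (Ic (a / (l - 1)))).
move=> x fg; rewrite /shifted => ->; rewrite Mop_cst /=.
move: fg; rewrite /shifted /g0 /= => fg.
rewrite mulrDr opprD addrACA fg -{2}[a / _]mul1r -mulrBl mulrCA mulfV// mulr1.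
by rewrite subrK.
Qed.

End L2_invertibility.

(** * Aperiodicity *)

Lemma expr_le_small (R : realType) (z e : R) : 0 <= z < 1 -> 0 < e ->
  exists n, z ^+ n <= e.
Proof.
move=> /andP[z0 z1] e0.
have /cvgr0_norm_le/(_ _ e0)[n _ /(_ n (leqnn n))] : z ^+ n @[n --> \oo] --> 0.
  by apply: cvg_expr; rewrite ger0_norm.
by rewrite ger0_norm ?exprn_ge0// => ?; exists n.
Qed.

Section aperiodicity.
Context {R : realType} {d : measure_display} {S : measurableType d}.
Variable mu : probability S R.
Variable P : R.-pker S ~> S.
Hypothesis biP : bistochastic mu P.

Lemma opnorm_bound (c : R) : (opnorm mu P 2%:E 3%:E < c%:E)%E ->
  exists2 K : R, 1 <= K < c & forall f, cLfun mu 2%:E f ->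
    (cLnorm mu 3%:E (Mop P f) <= K%:E * cLnorm mu 2%:E f)%E.
Proof.
move=> oc.
have ub f : cLfun mu 2%:E f -> (cLnorm mu 2%:E f <= 1)%E ->
    (cLnorm mu 3%:E (Mop P f) <= opnorm mu P 2%:E 3%:E)%E.
  by move=> Lf f1; apply: ereal_sup_ubound; exists f.
(* The constant 1 is fixed by [P] and has norm 1 in every L^p. The resulting [1 <= K] later makes T
   > 1, hence rho > 0. *)
have o1 : (1 <= opnorm mu P 2%:E 3%:E)%E.
  have n1 (p : R) : 0 < p -> cLnorm mu p%:E (cst 1) = 1%E.
    by move=> p0; rewrite cLnorm_cst// Normc.normc1.
  have := @ub (cst 1); rewrite Mop_cst !n1//; apply => //.
  exact: cLfun_cst.
have ofin : opnorm mu P 2%:E 3%:E \is a fin_num.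
  rewrite ge0_fin_numE ?(le_trans _ o1)//.
  by rewrite (lt_trans oc)// ltry.
exists (fine (opnorm mu P 2%:E 3%:E)).
  by rewrite -lee_fin -lte_fin fineK// o1.
have p12 : 1 <= 2 :> R by rewrite ler1n.
apply: (@cLnorm_le_of_unit_ball _ _ _ mu 2 _ (fun g => cLnorm mu 3%:E (Mop P g))) => //.
- by rewrite -lee_fin fineK// (le_trans _ o1).
- by move=> f a a0 Lf; exact: (cLnorm_MopZ biP p12).
- by move=> f Lf f1; rewrite fineK//; exact: ub.
Qed.

Lemma Mop_bounded_weaken (p q q' : R) : 0 < p -> 0 < q' <= q ->
  Mop_bounded mu P p q -> Mop_bounded mu P p q'.
Proof.
move=> p0 qq bpq; have [K K0 PK] := bpq.
exists (2 `^ q'^-1 * K); first by rewrite mulr_ge0 ?powR_ge0.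
move=> f Lf; apply: le_trans (cLnorm_monotone qq (Mop_bounded_cLfun p0 bpq Lf)) _.
by rewrite EFinM -muleA lee_wpmul2l ?lee_fin ?powR_ge0// PK.
Qed.

Section all_exponents.
Hypothesis b23 : Mop_bounded mu P 2 3.
Variable l : R[i].
Hypothesis l1 : normc l = 1.
Hypothesis inv2 : shifted_invertible mu P 2 l.

(** Induction on [n] with (2/3)^n p <= 2, each step going down from [p] to 2p/3. For p <= 3 that
    could fall below 2, and L^2 to L^3 is used directly. *)
Lemma shifted_invertible_ge2 (p : R) : 2 <= p -> shifted_invertible mu P p l.
Proof.
move=> p2; have p0 : 0 < p by rewrite (lt_le_trans _ p2).
have [n] : exists n, (2 / 3) ^+ n <= 2 / p :> R.
  apply: expr_le_small; last by rewrite divr_gt0.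
  by rewrite divr_ge0//= ltr_pdivrMr// mul1r ltr_nat.
rewrite ler_pdivlMr//; elim: n p p2 {p0} => [|n IH] p p2.
  by rewrite expr0 mul1r => pl2; rewrite (_ : p = 2)//; apply/eqP; rewrite eq_le pl2.
rewrite exprSr -mulrA => np.
have p0 : 0 < p by rewrite (lt_le_trans _ p2).
have [p3|p3] := leP p 3.
  apply: (@shifted_invertible_up _ _ _ mu P biP 2) => //.
    by rewrite ler1n.
  by apply: Mop_bounded_weaken b23 => //; rewrite p0.
have p'2 : 2 <= 2 / 3 * p by rewrite -mulrA ler_peMr// mulrC ler_pdivlMr// mul1r ltW.
have p'p : 2 / 3 * p <= p.
  by rewrite ler_piMl ?(ltW p0)// ler_pdivrMr// mul1r ler_nat.
apply: (@shifted_invertible_up _ _ _ mu P biP (2 / 3 * p)) => //.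
- by rewrite p'p (le_trans _ p'2)// ler1n.
- have -> : p = 3 / 2 * (2 / 3 * p) by field.
  rewrite [X in Mop_bounded _ _ X _](_ : _ = 2 / 3 * p); last by field.
  exact: Mop_bounded_ge2.
- exact: IH.
Qed.

Lemma shifted_invertible_gt1 (p : R) : 1 < p -> shifted_invertible mu P p l.
Proof.
move=> p1; have [|p2] := leP 2 p; first exact: shifted_invertible_ge2.
have p0 : 0 < p by rewrite (lt_trans _ p1).
(* The quantity 2(1 - 1/p) reaches 1 exactly when p reaches 2, and the passage from [p] to 3p/(4 -
   p) multiplies it by 4/3. *)
have [n] : exists n, (3 / 4) ^+ n <= 2 * (1 - p^-1).
  apply: expr_le_small; last by rewrite mulr_gt0// subr_gt0 invf_lt1.
  by rewrite divr_ge0//= ltr_pdivrMr// mul1r ltr_nat.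
elim: n p p1 p2 {p0} => [|n IH] p p1 p2; have p0 : 0 < p by rewrite (lt_trans _ p1).
  rewrite expr0 => h.
  have : 2 <= p; last by rewrite leNgt p2.
  have : p * 1 <= p * (2 * (1 - p^-1)) by rewrite ler_wpM2l// ltW.
  have -> : p * (2 * (1 - p^-1)) = 2 * p - 2 by field; rewrite gt_eqF.
  lra.
rewrite exprS => h; pose q := 3 * p / (4 - p).
have p4 : 0 < 4 - p by lra.
have pq : p <= q by rewrite /q ler_pdivlMr// mulrC ler_wpM2r ?(ltW p0)//; lra.
have q0 : 0 < q by rewrite (lt_le_trans p0).
apply: (@shifted_invertible_down _ _ _ mu P biP p q) => //.
- by rewrite (ltW p1).
- by apply: Mop_bounded_le2 => //; rewrite p1 ltW.
have [|q2] := leP 2 q; first exact: shifted_invertible_ge2.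
apply: IH => //; first exact: lt_le_trans pq.
have -> : 2 * (1 - q^-1) = (3 / 4)^-1 * (2 * (1 - p^-1)).
  by rewrite /q; field; rewrite !gt_eqF.
by rewrite ler_pdivlMl// divr_gt0.
Qed.

End all_exponents.

Lemma aperiodic_of_opnorm (r : R) : 1 < r ->
  (opnorm mu P 2%:E 3%:E < (2 `^ 6^-1)%:E)%E -> aperiodic mu P r%:E.
Proof.
move=> r1 /opnorm_bound[K /andP[K1 Kc] PK].
have K0 : 0 <= K by rewrite (le_trans _ K1).
pose T := (K * 2 `^ 2^-1) ^+ 3.
have s2 : 1 < 2 `^ 2^-1 :> R.
  by rewrite powR12_sqrt// -[ltLHS]sqrtr1 ltr_sqrt// ltr1n.
have T1 : 1 < T.
  by rewrite exprn_egt1// (lt_le_trans s2)// ler_peMl ?powR_ge0.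
(* The threshold enters here: 1/6 + 1/2 = 2/3 and the cube of 2^(2/3) is 4, so that (T - 1) / 3 <
   1. *)
have T4 : T < 4.
  have h : K * 2 `^ 2^-1 < 2 `^ (2 / 3).
    have -> : 2 / 3 = 6^-1 + 2^-1 :> R by field.
    by rewrite powRD ?pnatr_eq0 ?implybT// ltr_pM2r.
  have -> : 4 = (2 `^ (2 / 3)) ^+ 3 :> R.
    by rewrite -powR_mulrn ?powR_ge0// -powRrM divfK// powR_mulrn// -natrX.
  by rewrite ltrXn2r// mulr_ge0 ?powR_ge0.
have b23 : Mop_bounded mu P 2 3 by exists K.
have b22 : Mop_bounded mu P 2 2.
  by apply: Mop_bounded_weaken b23 => //; rewrite ler_nat andbT.
have rho01 : 0 < (T - 1) / 3 < 1.
  by rewrite divr_gt0 ?subr_gt0//= ltr_pdivrMr//; lra.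
have gap (u : S -> R) (m : R) : measurable_fun setT u ->
    (\int[mu]_x (u x ^+ 2)%:E <= m%:E)%E -> (\int[mu]_x u x)%R = 0 ->
    (\int[mu]_x (kavg P u x ^+ 2)%:E <= ((T - 1) / 3 * m)%:E)%E.
  by apply: kavg_gap => //; rewrite subr_ge0 ltW.
(* Exponents being positive, 1 is minimal; what remains is that no unimodular [l] other than 1 is in
   the spectrum. *)
split=> [|m []//]; split=> // l; rewrite /spectrum /= expr1 => sl l1.
apply: contrapT => /eqP ln1; apply: sl.
have nl1 : normc l = 1.
  by move: l1; rewrite normc_def -normc_sqrt => -[].
apply: shifted_invertible_resolvent; first exact: lt_trans r1.
apply: shifted_invertible_gt1 => //.
exact: (@shifted_invertible2 _ _ _ mu P biP _ rho01 gap).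
Qed.

End aperiodicity.

(** * The flip of two points *)

Section two_point_flip.
Variable R : realType.

Lemma measurable_negb : measurable_fun setT negb.
Proof. by []. Qed.

Let mu : probability bool R := bernoulli_prob 2^-1.
Let flip : R.-pker bool ~> bool := kdirac measurable_negb.

Lemma integral_fair_coin (g : bool -> \bar R) : (forall x, 0 <= g x)%E ->
  (\int[mu]_x g x = 2^-1%:E * (g true + g false))%E.
Proof.
move=> g0; rewrite integral_bernoulli_prob//; last first.
  by rewrite invr_ge0 ler0n invf_le1// ler1n.
rewrite ge0_muleDr//; congr (_ + _ * _)%E; congr EFin.
by rewrite /unstable.onem; field.
Qed.

Lemma Mop_flip f x : Mop flip f x = f (~~ x).
Proof.
rewrite /Mop /Rintegral !integral_dirac// !diracT !mul1e.
by case: (f _).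
Qed.

Lemma flip_bistochastic : bistochastic mu flip.
Proof.
move=> A mA; rewrite integral_fair_coin//.
rewrite -[in RHS](setIT A) -integral_indic// integral_fair_coin//.
by rewrite addeC.
Qed.

Lemma cLnorm_fair_coin_le (p s : R) (f : bool -> R[i]) : 0 < p -> 0 <= s ->
  (cLnorm mu p%:E f <= s%:E)%E =
  (normc (f true) `^ p + normc (f false) `^ p <= 2 * s `^ p).
Proof.
move=> p0 s0; rewrite cLnorm_le// integral_fair_coin; last first.
  by move=> x; rewrite lee_fin powR_ge0.
by rewrite -EFinD -EFinM lee_fin ler_pdivrMl.
Qed.

Lemma cLfun_fair_coin (p : R) (f : bool -> R[i]) : 0 < p -> cLfun mu p%:E f.
Proof.
move=> p0; split => //; apply/cLnorm_lty => //.
rewrite integral_fair_coin; last by move=> x; rewrite lee_fin powR_ge0.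
by rewrite -EFinD -EFinM ltry.
Qed.

Lemma flip_maps (p q : R) : 0 < q -> maps_Lp_Lq mu flip p%:E q%:E.
Proof. by move=> q0 f _; exact: cLfun_fair_coin. Qed.

(** If a^2 + b^2 <= 2 then [a] and [b] are at most 2^(1/2), so a^3 + b^3 <= 2^(1/2) (a^2 + b^2) <= 2
    * 2^(1/2), with equality when one of them is 0 and the other 2^(1/2). *)
Lemma flip_opnorm : (opnorm mu flip 2%:E 3%:E <= (2 `^ 6^-1)%:E)%E.
Proof.
have E : (2 `^ 6^-1) ^+ 3 = Num.sqrt 2 :> R.
  rewrite -powR_mulrn ?powR_ge0// -powRrM (_ : 6^-1 * 3 = 2^-1); last by field.
  exact: powR12_sqrt.
apply: ge_ereal_sup => _ [f [_ f1] <-].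
move: f1; rewrite !cLnorm_fair_coin_le ?powR_ge0// !Mop_flip /= powR1 mulr1.
rewrite !powR_mulrn ?normc_ge0 ?powR_ge0//.
rewrite E.
have := normc_ge0 (f false); have := normc_ge0 (f true).
set a := normc _; set b := normc _ => a0 b0 ab.
have s2 : Num.sqrt 2 ^+ 2 = 2 :> R by rewrite sqr_sqrtr.
have s0 := sqrtr_ge0 (2 : R).
have le_s (y z : R) : 0 <= y -> y ^+ 2 + z ^+ 2 <= 2 -> y <= Num.sqrt 2.
  move=> y0 yz; rewrite -ler_sqr ?nnegrE// s2 (le_trans _ yz)// lerDl sqr_ge0//.
have as2 : a <= Num.sqrt 2 by exact: le_s ab.
have bs2 : b <= Num.sqrt 2 by apply: (le_s _ a) => //; rewrite addrC.
have h1 : a ^+ 3 <= Num.sqrt 2 * a ^+ 2 by rewrite exprS ler_wpM2r ?sqr_ge0.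
have h2 : b ^+ 3 <= Num.sqrt 2 * b ^+ 2 by rewrite exprS ler_wpM2r ?sqr_ge0.
have h3 : Num.sqrt 2 * (a ^+ 2 + b ^+ 2) <= Num.sqrt 2 * 2 by rewrite ler_wpM2l.
rewrite mulrDr in h3.
lra.
Qed.

Lemma flip_ergodic : ergodic mu flip.
Proof.
move=> f _ fE; exists (f true); apply: filterS fE => x /(_ I) + _.
by rewrite Mop_flip; case: x.
Qed.

Lemma flip_not_aperiodic (r : R) : 0 < r -> ~ aperiodic mu flip r%:E.
Proof.
move=> r0 [[_ per] _].
have : ((-1) ^+ 1 : R[i]) != 1.
  by rewrite expr1 eq_sym -subr_eq0 opprK -mulr2n pnatr_eq0.
apply/negP/negPn/eqP/per; last by rewrite normrN normr1.
move=> [_ inj _].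
(* An eigenfunction of the flip for -1, which contradicts the injectivity of -1 - P because it is
   not almost everywhere 0. *)
pose f (x : bool) : R[i] := if x then 1 else -1.
have Lf : cLfun mu r%:E f by exact: cLfun_fair_coin.
have f0 : {ae mu, forall x, f x = cst 0 x}.
  have sf0 : shifted flip (-1) f = cst 0 %[ae mu].
    apply: aeW => x _; rewrite /shifted Mop_flip mulN1r /f /cst.
    by case: x => /=; rewrite ?opprK ?subrr// addrC subrr.
  by apply: filterS (inj _ Lf sf0) => x /(_ I).
have /cLfunP[mf _] := Lf.
have : (cLnorm mu r%:E f <= 0%:E)%E.
  rewrite (cLnorm_eq_ae r0 mf (cmeas_cst 0) f0) cLnorm_cst//.
  by rewrite Normc.normc0.
rewrite cLnorm_fair_coin_le// normcN Normc.normc1 powR1 powR0 ?gt_eqF// mulr0.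
by rewrite -mulr2n lern0.
Qed.

End two_point_flip.

Theorem theorem5p3 (R : realType) (r : R) (hr : 1 < r) :
  aperiodicity_bound r (2 `^ (6^-1)) /\
  (forall c : R, 2 `^ (6^-1) < c -> ~ aperiodicity_bound r c).
Proof.
split=> [d S mu P [biP _] _ _ ltP|c hc ab]; first exact: aperiodic_of_opnorm.
apply: (@flip_not_aperiodic R r); first exact: lt_trans hr.
apply: ab.
- split; first exact: flip_bistochastic.
  by exists 2%:E, 3%:E; split; rewrite ?lte_fin ?ltr1n ?ltr_nat//; exact: flip_maps.
- exact: flip_ergodic.
- exact: flip_maps.
- by apply: le_lt_trans (flip_opnorm R) _; rewrite lte_fin.
Qed.
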